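(* Let $(X,\mathcal F,m)$ be a $\sigma$-finite measure space, $\mathbb{K}\in\{\mathbb{R},\mathbb{C}\}$ and $n\in\mathbb{N}$, $n\ge 1$. Let $H\ge 0$ be a selfadjoint operator in $L^2(X;\mathbb{K}^n)$ and let $V:X\to\mathbb{K}^{n\times n}$ be measurable with $V(x)$ hermitian (symmetric if $\mathbb{K}=\mathbb{R}$) for every $x\in X$ and $V\in L^2\cap L^\infty(X;\mathbb{K}^{n\times n})$. Suppose that for some $t_0>0$ both $e^{-t_0H}$ and $e^{-t_0(H+V)}$ are bounded operators from $L^2(X;\mathbb{K}^n)$ to $L^\infty(X;\mathbb{K}^n)$. Then $$ \bigl\|e^{-2t_0H}-e^{-2t_0(H+V)}\bigr\|_{\mathrm{HS}} \leq \sqrt{n}\; \|V\|_{2,\mathrm{HS}} \Bigl(\|e^{-t_0H}\|_{2,\infty} + \|e^{-t_0(H+V)}\|_{2,\infty} \Bigr) \int_0^{t_0} \|e^{-s(H+V)}\|_{2,2}\, ds.$$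
   Context: The space $\mathbb{K}^n$ carries the Euclidean norm $|\cdot|$; $\|f\|_2^2=\int_X|f(x)|^2\,dm(x)$ and $\|f\|_\infty=\operatorname{ess\,sup}_{x}|f(x)|$ for $\mathbb{K}^n$-valued $f$. $\|T\|_{p,q}$ denotes the operator norm of $T$ from $L^p(X;\mathbb{K}^n)$ to $L^q(X;\mathbb{K}^n)$. $V$ acts as the multiplication operator $(Vf)(x)=V(x)f(x)$, which is bounded and selfadjoint on $L^2(X;\mathbb{K}^n)$ here, so $H+V$ is selfadjoint and lower-semibounded with the domain of $H$. For a measurable matrix function $V=(V_{ij})$, $$\|V\|_{2,\mathrm{HS}}^2:=\int_X\|V(x)\|_{\mathrm{HS}}^2\,dm(x)=\sum_{i,j=1}^n\|V_{ij}\|_2^2,$$ where $\|V(x)\|_{\mathrm{HS}}$ is the Hilbert--Schmidt (Frobenius) norm; $V\in L^2(X;\mathbb{K}^{n\times n})$ means $\|V\|_{2,\mathrm{HS}}<\infty$, and $V\in L^\infty(X;\mathbb{K}^{n\times n})$ means that $V$ is essentially bounded. On the left-hand side of the claim, $\|\cdot\|_{\mathrm{HS}}$ is the Hilbert--Schmidt norm of operators on $L^2(X;\mathbb{K}^n)$. Semigroups are defined by the spectral theorem. *)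

(* Defs.v *)
From HB Require Import structures.
From mathcomp Require Import all_boot all_order all_algebra.
From mathcomp Require Import complex.
From mathcomp Require Import all_classical all_reals all_analysis.

Set Implicit Arguments.
Unset Strict Implicit.
Unset Printing Implicit Defensive.

Import Order.TTheory GRing.Theory Num.Theory.
Import numFieldNormedType.Exports.

Local Open Scope classical_set_scope.
Local Open Scope ring_scope.

Inductive field_kind := RealScalars | ComplexScalars.

Section scalars.
Context (R : realType).

Definition sfield (k : field_kind) : numFieldType :=
  match k with
  | RealScalars => R : numFieldType
  | ComplexScalars => R[i] : numFieldType
  end.

Definition sRe (k : field_kind) : sfield k -> R :=
  match k return sfield k -> R with
  | RealScalars => fun x => x
  | ComplexScalars => fun z => complex.Re z
  end.

Definition sIm (k : field_kind) : sfield k -> R :=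
  match k return sfield k -> R with
  | RealScalars => fun=> 0
  | ComplexScalars => fun z => complex.Im z
  end.

(* a + ib; over the reals, the imaginary part is dropped *)
Definition smk (k : field_kind) : R -> R -> sfield k :=
  match k return R -> R -> sfield k with
  | RealScalars => fun a _ => a
  | ComplexScalars => fun a b => Complex a b
  end.

Definition sconj (k : field_kind) (z : sfield k) : sfield k :=
  smk k (sRe z) (- sIm z).

(* the norm of a numFieldType takes its values in the field itself *)
Definition sabs (k : field_kind) (z : sfield k) : R := sRe `|z|.

Context (k : field_kind) (n : nat).

Definition enorm (v : 'cV[sfield k]_n) : R :=
  Num.sqrt (\sum_(i < n) sabs (v i 0) ^+ 2).

Definition frobenius (A : 'M[sfield k]_n) : R :=
  Num.sqrt (\sum_(i < n) \sum_(j < n) sabs (A i j) ^+ 2).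

Definition is_hermitian (A : 'M[sfield k]_n) : Prop :=
  (map_mx (@sconj k) A)^T = A.

End scalars.

(* Elements of L^p(X; K^n) are represented by functions X -> K^n; statements
   about them are up to equality almost everywhere ([aeeq]). *)
Section L2_operators.
Context (R : realType) (k : field_kind) (d : measure_display)
  (X : measurableType d) (m : {measure set X -> \bar R}) (n : nat).

Local Notation K := (sfield R k).
Local Notation vfun := (X -> 'cV[K]_n).
Local Notation mfun := (X -> 'M[K]_n).

Definition scalar_measurable (f : X -> K) : Prop :=
  measurable_fun setT (fun x => sRe (f x)) /\
  measurable_fun setT (fun x => sIm (f x)).

Definition vec_measurable (f : vfun) : Prop :=
  forall i, scalar_measurable (fun x => f x i 0).

Definition mat_measurable (V : mfun) : Prop :=
  forall i j, scalar_measurable (fun x => V x i j).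

Definition vnorm (p : \bar R) (f : vfun) : \bar R :=
  Lnorm m p (fun x => (enorm (f x))%:E).

Definition mnorm (p : \bar R) (V : mfun) : \bar R :=
  Lnorm m p (fun x => (frobenius (V x))%:E).

Definition Lp (p : \bar R) : set vfun :=
  [set f | vec_measurable f /\ (vnorm p f < +oo)%E].

Definition aeeq (f g : vfun) : Prop := {ae m, forall x, f x = g x}.

Definition inner (f g : vfun) : K :=
  let h x := \sum_(i < n) f x i 0 * sconj (g x i 0) in
  smk k (Rintegral m setT (fun x => sRe (h x)))
        (Rintegral m setT (fun x => sIm (h x))).

(* The values of [act] outside [dom] are irrelevant. *)
Record partial_op := PartialOp { dom : set vfun ; act : vfun -> vfun }.

Definition linear_op (A : partial_op) : Prop :=
  [/\ dom A `<=` Lp 2%:E,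
      dom A (fun=> 0),
      (forall f, dom A f -> Lp 2%:E (act A f)),
      (forall f g, dom A f -> Lp 2%:E g -> aeeq f g ->
        dom A g /\ aeeq (act A f) (act A g)) &
      (forall (a : K) f g, dom A f -> dom A g ->
        dom A (fun x => a *: f x + g x) /\
        aeeq (act A (fun x => a *: f x + g x))
             (fun x => a *: act A f x + act A g x))].

Definition symmetric_op (A : partial_op) : Prop :=
  forall f g, dom A f -> dom A g -> inner (act A f) g = inner f (act A g).

Definition densely_defined (A : partial_op) : Prop :=
  forall f, Lp 2%:E f -> forall eps : R, 0 < eps ->
    exists2 g, dom A g & (vnorm 2%:E (fun x => f x - g x)%R < eps%:E)%E.

(* The last clause is A^* = A: on the left, g is in the domain of the adjoint
   and A^* g = h. *)
Definition selfadjoint (A : partial_op) : Prop :=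
  [/\ linear_op A, densely_defined A &
      forall g h, Lp 2%:E g -> Lp 2%:E h ->
        (forall f, dom A f -> inner (act A f) g = inner f h) <->
        (dom A g /\ aeeq (act A g) h)].

Definition nonneg_op (A : partial_op) : Prop :=
  forall f, dom A f -> 0 <= sRe (inner (act A f) f).

Definition mul_op (V : mfun) (f : vfun) : vfun := fun x => V x *m f x.

Definition perturbed (H : partial_op) (V : mfun) : partial_op :=
  PartialOp (dom H) (fun f x => act H f x + mul_op V f x).

Definition total_op (T : vfun -> vfun) : partial_op := PartialOp (Lp 2%:E) T.

(* A projection-valued measure E on the Borel sets of the real line, together
   with the sfield measures B |-> <E(B) f, f>; that these are measures is the
   (weak, hence strong) sigma-additivity of E. *)
Record spectral_measure := SpectralMeasure {
  sproj : set (measurableTypeR R) -> vfun -> vfun ;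
  smeas : vfun -> {measure set (measurableTypeR R) -> \bar R} ;
  sproj_linear : forall B, measurable B -> linear_op (total_op (sproj B)) ;
  sproj_symmetric : forall B, measurable B ->
    symmetric_op (total_op (sproj B)) ;
  sprojT : forall f, Lp 2%:E f -> aeeq (sproj setT f) f ;
  sprojI : forall B C f, measurable B -> measurable C -> Lp 2%:E f ->
    aeeq (sproj (B `&` C) f) (sproj B (sproj C f)) ;
  smeasE : forall B f, measurable B -> Lp 2%:E f ->
    smeas f B = (sRe (inner (sproj B f) f))%:E }.

(* A = \int phi dE: the domain of A is {f | \int phi^2 d<E f, f> < +oo}, and
   <A f, f> = \int phi d<E f, f> there. Since A is symmetric, this quadratic
   form determines A by polarization, also over the reals. *)
Definition spectral_integral (E : spectral_measure)
    (phi : measurableTypeR R -> R) (A : partial_op) : Prop :=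
  [/\ linear_op A, symmetric_op A,
      (forall f, dom A f <->
        Lp 2%:E f /\ (\int[smeas E f]_x (phi x ^+ 2)%:E < +oo)%E) &
      (forall f, dom A f ->
        ((sRe (inner (act A f) f))%:E = \int[smeas E f]_x (phi x)%:E)%E)].

(* T t = e^{-tA} on L^2 for all t >= 0, where e^{-tA} is \int e^{-t x} dE(x)
   for the spectral measure E of A *)
Definition is_semigroup (A : partial_op) (T : R -> vfun -> vfun) : Prop :=
  exists E : spectral_measure,
    spectral_integral E (fun x => x) A /\
    forall t, 0 <= t ->
      spectral_integral E (fun x => expR (- (t * x))) (total_op (T t)).

(* +oo when T does not map L^p boundedly to L^q *)
Definition opnorm (p q : \bar R) (T : vfun -> vfun) : \bar R :=
  ereal_sup [set vnorm q (T f) | f in [set f | Lp p f /\ (vnorm p f <= 1)%E]].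

Definition orthonormal_basis (B : set vfun) : Prop :=
  [/\ B `<=` Lp 2%:E,
      (forall e, B e -> inner e e = 1),
      (forall e e', B e -> B e' -> e <> e' -> inner e e' = 0) &
      (forall f, Lp 2%:E f -> (forall e, B e -> inner f e = 0) ->
        aeeq f (fun=> 0))].

Definition hs_along (B : set vfun) (T : vfun -> vfun) : \bar R :=
  sqrte (\esum_(e in B) (vnorm 2%:E (T e) ^+ 2)%E).

(* [hs_along B T] is the same for all orthonormal bases B; the supremum only
   serves to select this common value. L^2 need not be separable. *)
Definition hsnorm (T : vfun -> vfun) : \bar R :=
  ereal_sup [set hs_along B T | B in [set B | orthonormal_basis B]].

End L2_operators.

(* Main.v *)
(* Duhamel's formula writes <(e^(-2 t0 H) - e^(-2 t0 (H+V))) e, u> as the integral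
   over s in [0, 2 t0] of <V e^(-(2 t0 - s) H) e, e^(-s (H+V)) u>. For s <= t0 the
   factor V e^(-t0 H) splits off on the left, for s >= t0 the factor
   V e^(-t0 (H+V)) splits off on the right, and the remaining factors have norm
   at most 1 and ||e^(-s (H+V))||, resp. ||e^(-(s - t0) (H+V))||. An operator T
   bounded from L^2 to L^oo by C makes V T a Hilbert-Schmidt operator: for almost
   every x, testing |sum_j a_j (T f_j)(x)_i| <= C |a| with rational a shows
   sum_j |(T f_j)(x)_i|^2 <= C^2.
   To differentiate without a functional calculus, both semigroups are replaced
   by finite sums sum_i e^(-r lambda_i) E(B_i) over a grid of cells B_i of mesh
   delta, which are delta-close to them on spectral subspaces; the function to be
   differentiated is then a finite sum of exponentials. Adjoints are avoided by
   testing the difference D of the semigroups on a family e against an orthonormal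
   basis u of the span of the D e_j.
   Everything takes place in a real inner product space. In the complex case the
   real orthonormal family (e_j, i e_j) counts the sum of the |D e_j|^2 twice, and
   the real argument also loses a factor of two ([real_dim]) at each point x, since
   real and imaginary parts are bounded separately; the two factors cancel. *)

Require Import Defs.
From HB Require Import structures.
From mathcomp Require Import all_boot all_order all_algebra.
From mathcomp Require Import complex.
From mathcomp Require Import all_classical all_reals all_analysis.
From mathcomp Require Import measurable_realfun ess_sup_inf ring lra.

Import Order.TTheory GRing.Theory Num.Theory.
Import numFieldNormedType.Exports.

Local Open Scope classical_set_scope.
Local Open Scope ring_scope.

Set Implicit Arguments.
Unset Strict Implicit.
Unset Printing Implicit Defensive.

(** Only one factor of each Duhamel integrand is Hilbert-Schmidt; the other is merely bounded.
    Families of vectors are therefore measured by a Bessel bound ([bessel]), which a bounded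
    operator preserves up to its norm, and [bessel_pairing] combines the two kinds of information.
    The two halves of [[0, 2 t0]] are folded onto [[0, t0]], where they meet the same bound [h] and
    their constants add up; this puts the sum of the two smoothing norms in front of a single
    integral. The discretisation error has to be [delta] times a constant that may depend on the
    finite test families but not on the number of cells, because [delta] is fixed before the grid is
    made long enough for those families. As a spectral integral is given by its quadratic form,
    comparisons of operators go through polarization ([op_approx]). The factor sqrt n arises because
    the duality argument at a point is run in each coordinate of [K^n] separately. *)

(** * Cauchy-Schwarz and Bessel bounds in a semi-inner product space *)

Lemma discriminant_le (R : realFieldType) (A B C : R) : 0 <= A ->
  (forall t, 0 <= A * t ^+ 2 + 2 * C * t + B) -> C ^+ 2 <= A * B.
Proof.
rewrite le_eqVlt => /predU1P[<-|A0] q_ge0.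
  have [->|C0] := eqVneq C 0; first by rewrite expr0n/= mul0r.
  (* If [A = 0] and the slope is nonzero, the quadratic takes the value [-1] here. *)
  have := q_ge0 (- (B + 1) / (2 * C)).
  rewrite mul0r add0r [X in X + _](_ : _ = - (B + 1)); last by field.
  by rewrite mul0r; lra.
have := q_ge0 (- C / A).
have -> : A * (- C / A) ^+ 2 + 2 * C * (- C / A) + B = (A * B - C ^+ 2) / A.
  by field; rewrite gt_eqF.
by rewrite pmulr_lge0 ?invr_gt0// subr_ge0.
Qed.

Lemma sum_cauchy_schwarz (R : realFieldType) (I : Type) (r : seq I) (P : pred I)
    (a b : I -> R) :
  (\sum_(i <- r | P i) a i * b i) ^+ 2 <=
  (\sum_(i <- r | P i) a i ^+ 2) * (\sum_(i <- r | P i) b i ^+ 2).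
Proof.
apply: discriminant_le => [|t]; first by apply: sumr_ge0 => i _; exact: sqr_ge0.
have -> : (\sum_(i <- r | P i) a i ^+ 2) * t ^+ 2 +
    2 * (\sum_(i <- r | P i) a i * b i) * t + \sum_(i <- r | P i) b i ^+ 2 =
    \sum_(i <- r | P i) (a i * t + b i) ^+ 2.
  rewrite mulr_suml mulr_sumr mulr_suml -!big_split/=.
  by apply: eq_bigr => i _; ring.
by apply: sumr_ge0 => i _; exact: sqr_ge0.
Qed.

(* No definiteness is required, so that functions need not be identified when
   they are equal almost everywhere: identities between vectors are replaced by
   identities between their products with arbitrary vectors. *)
Record semi_inner (R : realType) (V : lmodType R) := SemiInner {
  ip :> V -> V -> R ;
  ipC : forall x y, ip x y = ip y x ;
  ipDl : forall x y z, ip (x + y) z = ip x z + ip y z ;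
  ipZl : forall a x y, ip (a *: x) y = a * ip x y ;
  ip_ge0 : forall x, 0 <= ip x x }.

Section semi_inner_theory.
Context (R : realType) (V : lmodType R) (b : semi_inner V).

Definition nm (x : V) : R := Num.sqrt (b x x).

Lemma ipDr x y z : b z (x + y) = b z x + b z y.
Proof. by rewrite ipC ipDl !(ipC b _ z). Qed.

Lemma ipZr a x y : b y (a *: x) = a * b y x.
Proof. by rewrite ipC ipZl (ipC b _ y). Qed.

Lemma ip0l x : b 0 x = 0.
Proof. by rewrite -(scale0r x) ipZl mul0r. Qed.

Lemma ipNl x y : b (- x) y = - b x y.
Proof. by rewrite -scaleN1r ipZl mulN1r. Qed.

Lemma ipNr x y : b y (- x) = - b y x.
Proof. by rewrite ipC ipNl (ipC b _ y). Qed.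

Lemma ipBl x y z : b (x - y) z = b x z - b y z.
Proof. by rewrite ipDl ipNl. Qed.

Lemma ipBr x y z : b z (x - y) = b z x - b z y.
Proof. by rewrite ipDr ipNr. Qed.

Lemma ip_suml I (r : seq I) (P : pred I) F y :
  b (\sum_(i <- r | P i) F i) y = \sum_(i <- r | P i) b (F i) y.
Proof.
by elim/big_rec2 : _ => [|i u v _ <-]; rewrite ?ip0l ?ipDl.
Qed.

Lemma ip_sumr I (r : seq I) (P : pred I) F y :
  b y (\sum_(i <- r | P i) F i) = \sum_(i <- r | P i) b y (F i).
Proof. by rewrite ipC ip_suml; apply: eq_bigr => i _; rewrite ipC. Qed.

Lemma nm_ge0 x : 0 <= nm x. Proof. exact: sqrtr_ge0. Qed.
Hint Resolve nm_ge0 : core.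

Lemma sqr_nm x : nm x ^+ 2 = b x x.
Proof. by rewrite sqr_sqrtr ?ip_ge0. Qed.

Lemma nm_le x c : 0 <= c -> b x x <= c ^+ 2 -> nm x <= c.
Proof. by move=> c0 h; rewrite -(@ler_pXn2r _ 2) ?nnegrE// sqr_nm. Qed.

Lemma ip_sqr_le x y : b x y ^+ 2 <= b x x * b y y.
Proof.
apply: discriminant_le => [|t]; first exact: ip_ge0.
have := ip_ge0 b (t *: x + y).
by rewrite !(ipDl, ipDr, ipZl, ipZr) (ipC b y x); lra.
Qed.

Lemma cauchy_schwarz x y : `|b x y| <= nm x * nm y.
Proof.
rewrite -(@ler_pXn2r _ 2) ?nnegrE ?mulr_ge0//.
by rewrite exprMn !sqr_nm real_normK ?num_real// ip_sqr_le.
Qed.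

Lemma ip_le_nm x y : b x y <= nm x * nm y.
Proof. exact: le_trans (ler_norm _) (cauchy_schwarz _ _). Qed.

Lemma nm0 : nm 0 = 0. Proof. by rewrite /nm ip0l sqrtr0. Qed.

Lemma nmZ a x : nm (a *: x) = `|a| * nm x.
Proof. by rewrite /nm ipZl ipZr mulrA -expr2 sqrtrM ?sqr_ge0// sqrtr_sqr. Qed.

Lemma nmN x : nm (- x) = nm x.
Proof. by rewrite -scaleN1r nmZ normrN1 mul1r. Qed.

Lemma nmBC x y : nm (x - y) = nm (y - x).
Proof. by rewrite -opprB nmN. Qed.

Lemma nmD x y : nm (x + y) <= nm x + nm y.
Proof.
apply: nm_le; first by rewrite addr_ge0.
rewrite !(ipDl, ipDr) (ipC b y x) -!sqr_nm.
by have := ip_le_nm x y; lra.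
Qed.

Lemma nm_le_dist x y : nm x <= nm y + nm (x - y).
Proof. by rewrite -{1}(subrKC y x) nmD. Qed.

Lemma nm_dual x c : 0 <= c -> (forall y, b x y <= c * nm y) -> nm x <= c.
Proof.
move=> c0 /(_ x); rewrite -sqr_nm expr2.
by have [->//|x0] := eqVneq (nm x) 0; rewrite ler_pM2r// lt_neqAle eq_sym x0/=.
Qed.

Definition orthonormal_family (K : nat) (u : nat -> V) := forall i j,
  (i < K)%N -> (j < K)%N -> b (u i) (u j) = (i == j)%:R.

(** The synthesis map sending [a] to the sum of the [a j *: f j] has norm at most [r] on l^2. Unlike
    orthonormality, this survives the application of a bounded operator ([bessel_comb]). *)
Definition bessel (r : R) (K : nat) (f : nat -> V) := forall a : nat -> R,
  b (\sum_(j < K) a j *: f j) (\sum_(j < K) a j *: f j) <=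
  r ^+ 2 * \sum_(j < K) a j ^+ 2.

Lemma orthonormal_lin K u (a : nat -> R) : orthonormal_family K u ->
  forall i, (i < K)%N -> b (\sum_(j < K) a j *: u j) (u i) = a i.
Proof.
move=> ou i iK; rewrite ip_suml (bigD1 (Ordinal iK))//= ipZl ou// eqxx mulr1.
rewrite big1 ?addr0// => j ji; rewrite ipZl ou//.
by move: ji; rewrite -val_eqE/= => /negPf ->; rewrite mulr0.
Qed.

Lemma bessel_orthonormal K u : orthonormal_family K u -> bessel 1 K u.
Proof.
move=> ou a; rewrite expr1n mul1r ip_sumr.
by apply: ler_sum => i _; rewrite ipZr (orthonormal_lin _ _)// expr2.
Qed.

(** Duality: the sum [s] is the product of [x] with the combination of the [f j] whose coefficients
    are [b (f j) x]. Cauchy-Schwarz gives [s ^ 2 <= r ^ 2 * s * b x x], and [s] cancels. *)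
Lemma bessel_inequality r K f x : bessel r K f ->
  \sum_(j < K) b (f j) x ^+ 2 <= r ^+ 2 * b x x.
Proof.
move=> bf; set s := leLHS.
have s0 : 0 <= s by apply: sumr_ge0 => i _; exact: sqr_ge0.
have sE : s = b (\sum_(j < K) b (f j) x *: f j) x.
  by rewrite ip_suml; apply: eq_bigr => i _; rewrite ipZl expr2.
have := ip_sqr_le (\sum_(j < K) b (f j) x *: f j) x; rewrite -sE.
move=> /le_trans/(_ (ler_wpM2r (ip_ge0 b x) (bf (fun j => b (f j) x)))).
rewrite -/s mulrAC expr2.
have [-> _|sN0] := eqVneq s 0; first by rewrite mulr_ge0 ?sqr_ge0 ?ip_ge0.
by rewrite ler_pM2r// lt_neqAle eq_sym sN0.
Qed.

(** Cauchy-Schwarz over pairs of indices, with the sum over [k] of [b (y j) (g k) ^ 2] controlled by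
    Bessel's inequality. The square sum is taken over the [y j] alone; the [g k] enter only through
    [r]. *)
Lemma bessel_pairing r J K (y g : nat -> V) (c : nat -> nat -> R) : 0 <= r ->
  bessel r K g ->
  `|\sum_(j < J) \sum_(k < K) c j k * b (y j) (g k)| <=
  r * Num.sqrt (\sum_(j < J) b (y j) (y j)) *
  Num.sqrt (\sum_(j < J) \sum_(k < K) c j k ^+ 2).
Proof.
move=> r0 bg.
have s1 : 0 <= \sum_(j < J) b (y j) (y j).
  by apply: sumr_ge0 => j _; exact: ip_ge0.
have s2 : 0 <= \sum_(j < J) \sum_(k < K) c j k ^+ 2.
  by apply: sumr_ge0 => j _; apply: sumr_ge0 => k _; exact: sqr_ge0.
rewrite -(@ler_pXn2r _ 2) ?nnegrE ?mulr_ge0 ?sqrtr_ge0//.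
rewrite real_normK ?num_real// !exprMn !sqr_sqrtr//.
rewrite !pair_bigA/=; apply: (le_trans (sum_cauchy_schwarz _ _ _ _)).
rewrite mulrC ler_wpM2r//; first by apply: sumr_ge0 => p _; exact: sqr_ge0.
rewrite -(pair_bigA _ (fun (j : 'I_J) (k : 'I_K) => b (y j) (g k) ^+ 2))/=.
rewrite mulr_sumr.
apply: ler_sum => j _; apply: le_trans (bessel_inequality (y j) bg).
by apply: ler_sum => k _; rewrite ipC.
Qed.

(** Membership in the span is expressed as equality in Bessel's inequality, which is all that a
    semidefinite form can see. A residual of length zero cannot be normalised and adds no vector. *)
Lemma gram_schmidt (s : seq V) : exists K u, orthonormal_family K u /\
  forall x, x \in s -> b x x = \sum_(k < K) b x (u k) ^+ 2.
Proof.
elim: s => [|x s [K [u [ou su]]]]; first by exists 0, (fun=> 0); split.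
pose p := \sum_(k < K) b x (u k) *: u k.
have pu i : (i < K)%N -> b (x - p) (u i) = 0.
  by move=> iK; rewrite ipBl (orthonormal_lin (fun k => b x (u k)))// subrr.
have pE : b (x - p) (x - p) = b x x - \sum_(k < K) b x (u k) ^+ 2.
  have xp0 : b (x - p) p = 0.
    by rewrite ip_sumr big1// => i _; rewrite ipZr pu// mulr0.
  rewrite [LHS]ipBr xp0 subr0 ipBl; congr (_ - _).
  by rewrite ip_suml; apply: eq_bigr => i _; rewrite ipZl ipC expr2.
have [p0|pN0] := eqVneq (b (x - p) (x - p)) 0.
  exists K, u; split => // z; rewrite inE => /predU1P[->|/su//].
  by apply/eqP; rewrite -subr_eq0 -pE p0.
have p_gt0 : 0 < nm (x - p).
  by rewrite sqrtr_gt0 lt_neqAle eq_sym pN0 ip_ge0.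
pose w := (nm (x - p))^-1 *: (x - p).
have ww : b w w = 1.
  by rewrite ipZl ipZr -sqr_nm; field; rewrite gt_eqF.
pose u' k := if k == K then w else u k.
have ou' : orthonormal_family K.+1 u'.
  move=> i j; rewrite !ltnS /u'.
  have [->|iK] := eqVneq i K; have [->|jK] := eqVneq j K; rewrite ?eqxx//.
  - by move=> _ jK'; rewrite ipZl pu ?mulr0 1?eq_sym ?(negPf jK)// ltn_neqAle jK.
  - by move=> iK' _; rewrite ipC ipZl pu ?mulr0 ?(negPf iK)// ltn_neqAle iK.
  - by move=> iK' jK'; rewrite ou// ltn_neqAle ?iK ?jK.
have sumE z : \sum_(k < K.+1) b z (u' k) ^+ 2 =
    \sum_(k < K) b z (u k) ^+ 2 + b z w ^+ 2.
  rewrite big_ord_recr/= /u' eqxx; congr (_ + _).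
  by apply: eq_bigr => i _; rewrite ltn_eqF.
exists K.+1, u'; split => // z; rewrite inE sumE => /predU1P[->|zs].
  have -> : b x w = nm (x - p).
    have xE : b (x - p) (x - p) = b x (x - p).
      rewrite ipBl (_ : b p (x - p) = 0) ?subr0//.
      by rewrite ip_suml big1// => i _; rewrite ipZl (ipC b (u i)) pu// mulr0.
    by rewrite ipZr -xE -sqr_nm; field; rewrite gt_eqF.
  by rewrite sqr_nm pE; ring.
(* For the earlier vectors the new direction can only increase the sum, and Bessel's inequality caps
   it at [b z z]. *)
apply/eqP; rewrite eq_le; apply/andP; split.
  by rewrite {1}su// lerDl sqr_ge0.
have := bessel_inequality z (bessel_orthonormal ou').
rewrite expr1n mul1r -sumE; apply: le_trans.
by apply: ler_sum => k _; rewrite ipC.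
Qed.

Lemma bessel_comb (r : R) K (f : nat -> V) (L : V -> V) :
  0 <= r -> (forall (a : nat -> R) y, b (L (\sum_(k < K) a k *: f k)) y =
    \sum_(k < K) a k * b (L (f k)) y) ->
  (forall x, nm (L x) <= r * nm x) ->
  bessel 1 K f -> bessel r K (fun k => L (f k)).
Proof.
move=> r0 Llin Lr bf a; set w := \sum_(k < K) a k *: f k.
have E1 y : b (\sum_(k < K) a k *: L (f k)) y = b (L w) y.
  by rewrite Llin ip_suml; apply: eq_bigr => k _; rewrite ipZl.
rewrite E1 ipC E1 -sqr_nm.
apply: (@le_trans _ _ ((r * nm w) ^+ 2)).
  by rewrite lerXn2r ?nnegrE ?mulr_ge0 ?nm_ge0.
rewrite exprMn ler_wpM2l ?sqr_ge0// sqr_nm.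
by have := bf a; rewrite expr1n mul1r.
Qed.

Lemma ip_dist x x' y y' :
  `|b x y - b x' y'| <= nm (x - x') * nm y + nm x' * nm (y - y').
Proof.
have -> : b x y - b x' y' = b (x - x') y + b x' (y - y').
  by rewrite ipBl ipBr; ring.
by apply: (le_trans (ler_normD _ _)); apply: lerD; exact: cauchy_schwarz.
Qed.

(** Symmetry supplies the linearity: [b (L x - L y) z = b (x - y) (L z) = b (L (x - y)) z]. *)
Lemma op_dist (M : R) (L : V -> V) x y : 0 <= M ->
  (forall x y, b (L x) y = b x (L y)) -> (forall x, nm (L x) <= M * nm x) ->
  nm (L x - L y) <= M * nm (x - y).
Proof.
move=> M0 Ls LM; apply: nm_dual => [|z]; first by rewrite mulr_ge0 ?nm_ge0.
rewrite ipBl !Ls -ipBl -Ls; apply: (le_trans (ip_le_nm _ _)).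
by rewrite ler_wpM2r ?nm_ge0.
Qed.

Lemma nm_orthonormal N f i : orthonormal_family N f -> (i < N)%N -> nm (f i) = 1.
Proof. by move=> f_on iN; rewrite /nm f_on// eqxx sqrtr1. Qed.

Lemma bessel_mono r1 r2 N f : 0 <= r1 -> r1 <= r2 -> bessel r1 N f -> bessel r2 N f.
Proof.
move=> r10 r12 bf a; apply: (le_trans (bf a)); rewrite ler_wpM2r//.
  by apply: sumr_ge0 => i _; exact: sqr_ge0.
by rewrite lerXn2r// nnegrE// (le_trans r10).
Qed.

End semi_inner_theory.

(** * Spectral measures and integrals, tested weakly *)

Record spectral_family (R : realType) (V : lmodType R) (b : semi_inner V) :=
  SpectralFamily {
  eproj : set (measurableTypeR R) -> V -> V ;
  emeas : V -> {measure set (measurableTypeR R) -> \bar R} ;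
  eproj_sym : forall B x y, measurable B -> b (eproj B x) y = b x (eproj B y) ;
  eprojT : forall x y, b (eproj setT x) y = b x y ;
  eprojI : forall B C x y, measurable B -> measurable C ->
    b (eproj (B `&` C) x) y = b (eproj B (eproj C x)) y ;
  emeasE : forall B x, measurable B -> emeas x B = (b (eproj B x) x)%:E }.

Record op_integral (R : realType) (V : lmodType R) (b : semi_inner V)
    (E : spectral_family b) (phi : measurableTypeR R -> R) (D : set V)
    (A : V -> V) : Prop := OpIntegral {
  op_dom : forall x, D x <-> (\int[emeas E x]_t (phi t ^+ 2)%:E < +oo)%E ;
  op_domD : forall a x y, D x -> D y -> D (a *: x + y) ;
  op_lin : forall a x y z, D x -> D y ->
    b (A (a *: x + y)) z = a * b (A x) z + b (A y) z ;
  op_sym : forall x y, D x -> D y -> b (A x) y = b x (A y) ;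
  op_form : forall x, D x ->
    ((b (A x) x)%:E = \int[emeas E x]_t (phi t)%:E)%E }.

Section spectral_family_theory.
Context (R : realType) (V : lmodType R) (b : semi_inner V)
  (E : spectral_family b).
Local Notation P := (eproj E).
Local Notation mu := (emeas E).
Implicit Types (x y z : V).

Lemma ip_eproj B C x y : measurable B -> measurable C ->
  b (P B x) (P C y) = b (P (B `&` C) x) y.
Proof. by move=> mB mC; rewrite -eproj_sym// -eprojI// setIC. Qed.

Lemma ip_eprojxx B x y : measurable B -> b (P B x) (P B y) = b (P B x) y.
Proof. by move=> mB; rewrite ip_eproj// setIid. Qed.

Lemma emeas_nm B x : measurable B -> mu x B = (b (P B x) (P B x))%:E.
Proof. by move=> mB; rewrite emeasE// ip_eprojxx. Qed.

Lemma emeasT x : mu x setT = (b x x)%:E.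
Proof. by rewrite emeasE// eprojT. Qed.

Lemma emeas_fin B x : measurable B -> mu x B \is a fin_num.
Proof. by move=> mB; rewrite emeasE. Qed.

Lemma emeas_le B x : measurable B -> (mu x B <= (b x x)%:E)%E.
Proof. by move=> mB; rewrite -emeasT le_measure ?inE. Qed.

Lemma eproj_null B C x y : measurable B -> measurable C -> C `<=` B ->
  mu x B = 0%E -> b (P C x) y = 0.
Proof.
move=> mB mC CB xB.
have : mu x C = 0%E by apply/eqP; rewrite eq_le measure_ge0 -xB le_measure ?inE.
rewrite emeas_nm// => -[xC]; apply/eqP; rewrite -sqrf_eq0 eq_le sqr_ge0 andbT.
by apply: (le_trans (ip_sqr_le _ _ _)); rewrite xC mul0r.
Qed.

Lemma ip_eprojDl B x y z : measurable B ->
  b (P B (x + y)) z = b (P B x) z + b (P B y) z.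
Proof. by move=> mB; rewrite !eproj_sym// ipDl. Qed.

Lemma ip_eprojZl B a x z : measurable B -> b (P B (a *: x)) z = a * b (P B x) z.
Proof. by move=> mB; rewrite !eproj_sym// ipZl. Qed.

(** The additional terms all pair [P C x] with some vector, and such products vanish. Consequently
    [x + y] and [x - y] have the same spectral measure wherever [x] has no mass. *)
Lemma emeasDl B C x y : measurable B -> measurable C -> C `<=` B ->
  mu x B = 0%E -> mu (x + y) C = mu y C.
Proof.
move=> mB mC CB xB; rewrite !emeasE//; congr (_%:E).
rewrite ip_eprojDl// (eproj_null _ mB)// add0r ipDr eproj_sym//.
by rewrite (ipC b y) (eproj_null _ mB)// add0r eproj_sym.
Qed.

Lemma emeasZ B a x : measurable B -> mu (a *: x) B = ((a ^+ 2)%:E * mu x B)%E.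
Proof. by move=> mB; rewrite !emeasE// -EFinM ip_eprojZl// ipZr mulrA -expr2. Qed.

Lemma emeas_eproj B C x : measurable B -> measurable C ->
  mu (P B x) C = mu x (B `&` C).
Proof.
move=> mB mC; have mBC := measurableI _ _ mB mC.
rewrite !emeasE// -eprojI// ip_eproj//; last exact: measurableI.
by rewrite -setIA setIid setIC.
Qed.

End spectral_family_theory.

Section op_integral_theory.
Context (R : realType) (V : lmodType R) (b : semi_inner V)
  (E : spectral_family b) (phi : measurableTypeR R -> R) (D : set V)
  (A : V -> V).
Hypotheses (mphi : measurable_fun setT phi) (EA : op_integral E phi D A).
Local Notation P := (eproj E).
Local Notation mu := (emeas E).

Lemma emeas_integrable_cst x (r : R) : (mu x).-integrable setT (EFin \o cst r).
Proof.
apply/integrableP; split; first exact/measurable_EFinP.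
rewrite (eq_integral (cst `|r|%:E))// integral_cst//.
by rewrite emeasT -EFinM ltry.
Qed.

(** The measure [mu x] is finite, so [|phi| <= 1 + phi ^ 2] deduces integrability from square
    integrability. *)
Lemma op_integrable x : D x -> (mu x).-integrable setT (EFin \o phi).
Proof.
move=> /(op_dom EA) phi2.
have iphi2 : (mu x).-integrable setT (fun t => (phi t ^+ 2)%:E).
  apply/integrableP; split.
    by apply/measurable_EFinP; exact: measurable_funX.
  by under eq_integral do rewrite /= ger0_norm ?sqr_ge0//.
apply: (le_integrable _ _ _ (integrableD _ (emeas_integrable_cst x 1) iphi2)) => //.
  exact/measurable_EFinP.
move=> t _; rewrite -[leLHS]/(`|phi t|%:E) -[leRHS]/(`|1 + phi t ^+ 2|%:E) lee_fin.
rewrite [leRHS]ger0_norm ?addr_ge0 ?sqr_ge0// -real_normK ?num_real//.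
by have := sqr_ge0 (`|phi t| - 1); have := normr_ge0 (phi t); nra.
Qed.

Lemma op_formR x : D x -> b (A x) x = \int[mu x]_t phi t.
Proof. by move=> Dx; rewrite /Rintegral -(op_form EA Dx). Qed.

Lemma dom_bounded (U : set (measurableTypeR R)) K x : measurable U ->
  (forall t, U t -> `|phi t| <= K) -> mu x (~` U) = 0%E -> D x.
Proof.
move=> mU phiK xU; apply/(op_dom EA).
have mphi2 : measurable_fun setT (fun t => (phi t ^+ 2)%:E).
  by apply/measurable_EFinP; exact: measurable_funX.
rewrite -(setvU U) ge0_integral_setU//=; first last.
- by rewrite disj_set2E setICl.
- by move=> t _; rewrite lee_fin sqr_ge0.
- by rewrite setvU.
- exact: measurableC.
rewrite null_set_integral//; first last.
- exact: measurable_funTS.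
- exact: measurableC.
rewrite add0e; apply: (@le_lt_trans _ _ (\int[mu x]_(t in U) (K ^+ 2)%:E)%E).
  apply: ge0_le_integral => //.
  - by move=> t _; rewrite lee_fin sqr_ge0.
  - exact: measurable_funTS.
  - move=> t /phiK Kt; rewrite lee_fin -real_normK ?num_real//.
    by rewrite lerXn2r ?nnegrE// (le_trans _ Kt).
by rewrite integral_cst// emeasE// -EFinM ltry.
Qed.

Section step_approximation.
Context (p : nat) (B : nat -> set (measurableTypeR R)) (alpha : nat -> R)
  (U : set (measurableTypeR R)) (eps : R).
Hypotheses (eps0 : 0 <= eps) (mB : forall i, measurable (B i)) (mU : measurable U).
Let step t := \sum_(i < p) alpha i * \1_(B i) t.
Hypothesis eps_ge : forall t, U t -> `|phi t - step t| <= eps.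

Let indic_integrable x (r : R) i :
  (mu x).-integrable setT (EFin \o (fun t => r * \1_(B i) t)).
Proof.
apply: (le_integrable _ _ _ (emeas_integrable_cst x r)) => //.
  by apply/measurable_EFinP; exact: measurable_funM.
move=> t _ /=; rewrite !lee_fin normrM ler_piMr//.
by rewrite indicE; case: (_ \in _); rewrite ?normr1 ?normr0.
Qed.

Let step_integral x : (mu x).-integrable setT (EFin \o step) /\
  \int[mu x]_t step t = \sum_(i < p) alpha i * b (P (B i) x) x.
Proof.
rewrite /step; elim: p => [|q [iq qE]].
  split; last first.
    by rewrite big_ord0 /Rintegral; under eq_integral do rewrite big_ord0;
      rewrite integral0.
  by under eq_fun do rewrite /= big_ord0; exact: (emeas_integrable_cst x 0).
have -> : (fun t => \sum_(i < q.+1) alpha i * \1_(B i) t) =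
  (fun t => \sum_(i < q) alpha i * \1_(B i) t + alpha q * \1_(B q) t).
  by apply/funext => t; rewrite big_ord_recr.
split.
  exact: (integrableD _ iq (indic_integrable x (alpha q) q)).
rewrite RintegralD// big_ord_recr/= qE; congr (_ + _).
rewrite RintegralZl//; last first.
  by apply: eq_integrable (indic_integrable x 1 q) => // t _; rewrite /= mul1r.
by rewrite /Rintegral integral_indic// setIT emeasE.
Qed.

Let form_integral x : D x ->
  b (A x) x - \sum_(i < p) alpha i * b (P (B i) x) x =
  \int[mu x]_t (phi t - step t).
Proof.
move=> Dx; have [istep stepE] := step_integral x.
by rewrite RintegralB -?op_formR ?stepE//; exact: op_integrable.
Qed.

Let form_integrable x : D x ->
  (mu x).-integrable setT (EFin \o (fun t => phi t - step t)).
Proof.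
move=> Dx; have [istep _] := step_integral x.
exact: (integrableB _ (op_integrable Dx) istep).
Qed.

(* Splitting the real line into U and its complement: the spectral measures of
   z and w agree on the complement. *)
Let form_diff z w : D z -> D w ->
  (forall C, measurable C -> C `<=` ~` U -> mu z C = mu w C) ->
  `|(b (A z) z - \sum_(i < p) alpha i * b (P (B i) z) z) -
    (b (A w) w - \sum_(i < p) alpha i * b (P (B i) w) w)| <=
  eps * (b z z + b w w).
Proof.
move=> Dz Dw zw; rewrite !form_integral//.
have mUC := measurableC mU.
have dUC : [disjoint U & ~` U] by rewrite disj_set2E setICr.
have split x : D x -> \int[mu x]_t (phi t - step t) =
    \int[mu x]_(t in U) (phi t - step t) +
    \int[mu x]_(t in ~` U) (phi t - step t).
  by move=> Dx; rewrite -Rintegral_setU ?setUv//; exact: form_integrable.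
have small x : D x -> `|\int[mu x]_(t in U) (phi t - step t)| <= eps * b x x.
  move=> Dx; have iU := integrableS measurableT mU (@subsetT _ U) (form_integrable Dx).
  apply: (le_trans (le_normr_Rintegral mU iU)).
  have ieps := integrableS measurableT mU (@subsetT _ U)
    (emeas_integrable_cst x eps).
  apply: (@le_trans _ _ (\int[mu x]_(t in U) eps)).
    by apply: le_Rintegral => //; exact: integrable_norm iU.
  rewrite Rintegral_cst//.
  rewrite ler_wpM2l//.
  by rewrite -lee_fin fineK ?emeas_fin// emeas_le.
rewrite !split//.
have -> : \int[mu z]_(t in ~` U) (phi t - step t) =
          \int[mu w]_(t in ~` U) (phi t - step t).
  by congr fine; exact: eq_measure_integral.
rewrite opprD addrACA subrr addr0 mulrDr.
by apply: (le_trans (ler_normB _ _)); rewrite lerD ?small.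
Qed.

Let q z w := b (A z) w - \sum_(i < p) alpha i * b (P (B i) z) w.

Let q_lin a z w v : D z -> D w -> q (a *: z + w) v = a * q z v + q w v.
Proof.
move=> Dz Dw; rewrite /q (op_lin EA)//.
rewrite (eq_bigr (fun i : 'I_p => a * (alpha i * b (P (B i) z) v) +
                                  alpha i * b (P (B i) w) v)).
  by rewrite big_split/= -mulr_sumr; ring.
by move=> i _; rewrite ip_eprojDl// ip_eprojZl//; ring.
Qed.

Let q_sym z w : D z -> D w -> q z w = q w z.
Proof.
move=> Dz Dw; rewrite /q (op_sym EA)// ipC; congr (_ - _).
by apply: eq_bigr => i _; rewrite eproj_sym// ipC.
Qed.

Let q_polarization x y : D x -> D y ->
  q (x + y) (x + y) - q (x - y) (x - y) = 4 * q x y.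
Proof.
move=> Dx Dy.
have Dxy : D (1 *: x + y) by exact: (op_domD EA).
have Dyx : D ((- 1) *: y + x) by exact: (op_domD EA).
rewrite -{1 2}(scale1r x) (addrC x (- y)) -scaleN1r.
rewrite (q_lin _ _ Dx Dy) (q_lin _ _ Dy Dx).
rewrite (q_sym Dx Dxy) (q_sym Dy Dxy) (q_sym Dx Dyx) (q_sym Dy Dyx).
rewrite !(q_lin _ _ Dx Dy) !(q_lin _ _ Dy Dx) (q_sym Dy Dx); ring.
Qed.

(** Only quadratic forms are given, so the product with [y] is recovered by polarization. The vector
    [y] may have spectral mass outside [U], where nothing bounds [phi - step]; but [x + y] and
    [x - y] have the same spectral measure there, so these contributions cancel in [form_diff]. *)
Lemma op_approx x y : D x -> D y -> mu x (~` U) = 0%E ->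
  `|b (A x) y - \sum_(i < p) alpha i * b (P (B i) x) y| <= eps * nm b x * nm b y.
Proof.
move=> Dx Dy xU; rewrite -/(q x y).
have bound z : D z -> mu z (~` U) = 0%E ->
    `|q z y| <= eps / 2 * (b z z + b y y).
  move=> Dz zU.
  have Dzy : D (z + y) by rewrite -(scale1r z); exact: (op_domD EA).
  have Dyz : D (z - y).
    by rewrite addrC -scaleN1r; exact: (op_domD EA).
  have mUC := measurableC mU.
  have := @form_diff (z + y) (z - y) Dzy Dyz.
  have -> : b (z + y) (z + y) + b (z - y) (z - y) = 2 * (b z z + b y y).
    by rewrite !(ipDl, ipDr, ipNl, ipNr) (ipC b y z); ring.
  rewrite -![_ - \sum_(i < p) _]/(q _ _) q_polarization// normrM ger0_norm//.
  rewrite mulrA => /(_ _)/wrap[|h].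
    move=> C mC CU; rewrite !(emeasDl _ mUC mC CU)//.
    by rewrite -scaleN1r emeasZ// sqrrN expr1n mul1e.
  by move: h; lra.
rewrite -(@ler_pXn2r _ 2) ?nnegrE ?mulr_ge0 ?nm_ge0//.
rewrite real_normK ?num_real// !exprMn !sqr_nm.
(* Replacing [x] by [t *: x] turns the additive bound into a nonnegative quadratic in [t], whose
   discriminant yields the product of the norms. *)
have : (q x y / 2) ^+ 2 <= (eps / 2 * b x x) * (eps / 2 * b y y).
  apply: discriminant_le => [|t]; first by rewrite !mulr_ge0 ?ip_ge0.
  have Dt : D (t *: x).
    (* Closure of [D] is stated for [a *: x + y], hence [t *: x] is read as [(t - 1) *: x + x]. *)
    by rewrite -(subrK 1 t) scalerDl scale1r; exact: (op_domD EA).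
  have qt : q (t *: x) y = t * q x y.
    by rewrite -(subrK 1 t) scalerDl scale1r q_lin//; ring.
  have := bound _ Dt; rewrite emeasZ ?xU ?mule0//; last exact: measurableC.
  move=> /(_ erefl); rewrite qt ipZl ipZr => /ler_normlP[+ _].
  by lra.
by lra.
Qed.

End step_approximation.
End op_integral_theory.

(** * From a lower bound of the form to the support of the spectral measure *)

Section lower_bound.
Context (R : realType) (V : lmodType R) (b : semi_inner V)
  (E : spectral_family b) (D : set V) (A : V -> V) (c : R).
Hypotheses (EA : op_integral E (fun t => t) D A)
  (A_ge : forall x, D x -> - c * b x x <= b (A x) x).
Local Notation P := (eproj E).
Local Notation mu := (emeas E).
Local Notation mT := (measurableTypeR R).

Lemma emeas_setCI (B : set mT) x : measurable B -> mu (P B x) (~` B) = 0%E.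
Proof.
by move=> mB; rewrite emeas_eproj ?setICr ?measure0//; exact: measurableC.
Qed.

(** On [[lo, hi]] the constant midpoint approximates the spectral variable to within half the
    length, and midpoint plus half the length is [hi]. *)
Lemma form_le_on_itv (B : set mT) (lo hi : R) x : measurable B ->
  lo <= hi -> B `<=` `[lo, hi]%classic ->
  D (P B x) /\ b (A (P B x)) (P B x) <= hi * b (P B x) (P B x).
Proof.
move=> mB lh Blh.
have bound t : B t -> `|t - (lo + hi) / 2| <= (hi - lo) / 2.
  by move=> /Blh/=; rewrite in_itv/= => /andP[lt th]; rewrite ler_norml; lra.
have DPx : D (P B x).
  apply: (dom_bounded (K := `|lo| + `|hi|) _ EA mB _ (emeas_setCI x mB)) => //.
  move=> t /Blh/=; rewrite in_itv/= => /andP[lt th].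
  have := ler_norm hi; have := ler_norm (- lo); rewrite normrN => h1 h2.
  by have := normr_ge0 lo; have := normr_ge0 hi; rewrite ler_norml; lra.
split => //.
have := @op_approx R V b E (fun t => t) D A _ EA 1 (fun=> B)
  (fun=> (lo + hi) / 2) B ((hi - lo) / 2) _ (fun=> mB) mB _ (P B x) (P B x)
  DPx DPx (emeas_setCI x mB).
move=> /(_ _ _ _)/wrap[] //; first by rewrite divr_ge0// subr_ge0.
  by move=> t Bt; rewrite big_ord_recl big_ord0 addr0 indicE mem_set// mulr1 bound.
rewrite big_ord_recl big_ord0 addr0 -[leRHS]mulrA -expr2 sqr_nm.
rewrite -(eprojI E x _ mB mB) setIid.
by move=> /ler_normlP[_]; lra.
Qed.

(** On the range of [P (B n)] the form is at most [- c - 1 / (n + 1)] times the squared length,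
    against the lower bound [- c]; hence each [B n] is null. These bounded intervals, kept away from
    [- c], exhaust the half-line. *)
Lemma emeas_below x : mu x `]-oo, - c[%classic = 0%E.
Proof.
pose B n : set mT := `[- c - n.+1%:R, - c - n.+1%:R^-1[%classic.
have mB n : measurable (B n) by exact: measurable_itv.
have B0 n : mu x (B n) = 0%E.
  have [|||DPx] := @form_le_on_itv (B n) (- c - n.+1%:R) (- c - n.+1%:R^-1) x => //.
  - rewrite lerD2l lerN2 (@le_trans _ _ 1) ?invf_le1 ?ler1n//.
  - by move=> t; rewrite /B/= !in_itv/= => /andP[-> /ltW].
  rewrite emeas_nm//; have := A_ge DPx; set g := P (B n) x => h1 h2.
  congr (_%:E); apply/eqP; rewrite eq_le ip_ge0 andbT.
  have r0 : 0 < n.+1%:R^-1 :> R by rewrite invr_gt0.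
  rewrite -(pmulr_rle0 _ r0); move: h1 h2; set r := _^-1; lra.
have -> : `]-oo, - c[%classic = \bigcup_n B n.
  apply/seteqP; split => t /=; rewrite in_itv/=.
    move=> tc; set s := - c - t; have s0 : 0 < s by rewrite subr_gt0.
    (* One index serves both endpoints of [B n]: [n.+1] exceeds [s] as well as [s^-1]. *)
    have := truncnS_gt (s + s^-1); set n := Num.truncn _ => sn.
    exists n => //; rewrite /B/= in_itv/=.
    have si : 0 < s^-1 by rewrite invr_gt0.
    have n0 : 0 < n.+1%:R :> R by [].
    have h : n.+1%:R^-1 < s by rewrite invf_plt ?posrE//; lra.
    have -> : t = - c - s by rewrite /s; ring.
    by rewrite lerD2l lerN2 ltrD2l ltrN2 h andbT; lra.
  move=> [n _]; rewrite /B/= in_itv/= => /andP[_].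
  have : 0 < n.+1%:R^-1 :> R by rewrite invr_gt0.
  by set r := _^-1; lra.
apply: measure_negligible; first exact: bigcupT_measurable.
by apply: negligible_bigcup => n; apply/negligibleP => //; exact: B0.
Qed.

Lemma emeas_belowC x : mu x (~` `[- c, +oo[%classic) = 0%E.
Proof. by rewrite setCitvr emeas_below. Qed.

(** This is [op_approx] with the empty step function: the error is then the supremum of
    [expR (- (s * t))] over [[- c, +oo[], which carries every spectral measure. *)
Lemma semigroup_bound (s : R) (T : V -> V) x : 0 <= s ->
  op_integral E (fun t => expR (- (s * t))) setT T ->
  nm b (T x) <= expR (s * c) * nm b x.
Proof.
move=> s0 ET; apply: nm_dual => [|y]; first by rewrite mulr_ge0 ?nm_ge0 ?expR_ge0.
have mU : measurable (`[- c, +oo[%classic : set mT) by exact: measurable_itv.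
have mphi : measurable_fun setT (fun t : mT => expR (- (s * t))).
  by apply: measurableT_comp => //; apply: measurableT_comp => //; exact: measurable_funM.
have := @op_approx R V b E _ setT T mphi ET 0 (fun=> setT)
  (fun=> 0) `[- c, +oo[%classic (expR (s * c)) _ (fun=> measurableT) mU _ x y I I
  (emeas_belowC x).
move=> /(_ _ _)/wrap[]; first exact: expR_ge0.
  move=> t /=; rewrite in_itv/= andbT => ct.
  rewrite big_ord0 subr0 ger0_norm ?expR_ge0// ler_expR -mulrN ler_wpM2l//; lra.
by rewrite big_ord0 subr0; exact: (le_trans (ler_norm _)).
Qed.

End lower_bound.

(** * Step functions of an operator on a grid of spectral cells *)

Section grid.
Context (R : realType) (V : lmodType R) (b : semi_inner V)
  (E : spectral_family b) (D : set V) (A : V -> V) (c : R).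
Hypotheses (EA : op_integral E (fun t => t) D A)
  (A_ge : forall x, D x -> - c * b x x <= b (A x) x).
Context (p : nat) (delta : R) (delta_gt0 : 0 < delta).
Local Notation P := (eproj E).
Local Notation mu := (emeas E).
Local Notation mT := (measurableTypeR R).

Definition grid_pt (i : nat) : R := - c + i%:R * delta.
Definition grid_cell (i : nat) : set mT := `[grid_pt i, grid_pt i.+1[%classic.
Definition grid_op (a : nat -> R) (x : V) : V :=
  \sum_(i < p) a i *: P (grid_cell i) x.

Local Notation lam := grid_pt.
Local Notation B := grid_cell.
Local Notation L := grid_op.
Let U : set mT := `[- c, lam p[%classic.

Lemma measurable_grid_cell i : measurable (B i). Proof. exact: measurable_itv. Qed.
Hint Resolve measurable_grid_cell : core.

Let mU : measurable U. Proof. exact: measurable_itv. Qed.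
Hint Resolve mU : core.

Lemma grid_pt_le i j : (i <= j)%N -> lam i <= lam j.
Proof. by move=> ij; rewrite lerD2l ler_pM2r// ler_nat. Qed.

Lemma grid_pt0 : lam 0 = - c. Proof. by rewrite /grid_pt mul0r addr0. Qed.

Lemma grid_ptS i : lam i.+1 = lam i + delta.
Proof. by rewrite /grid_pt -natr1; ring. Qed.

Lemma grid_pt_ge i : - c <= lam i. Proof. by rewrite -grid_pt0 grid_pt_le. Qed.

Lemma grid_cell_disj i j : i != j -> B i `&` B j = set0.
Proof.
wlog ij : i j / (i < j)%N => [h ij|_].
  case: (ltngtP i j) => [||ji]; last by rewrite ji eqxx in ij.
  - by move=> /h; exact.
  - by move=> ji; rewrite setIC h// eq_sym.
apply/seteqP; split => // t []; rewrite /B/= !in_itv/= => /andP[_ ti] /andP[jt _].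
by have := lt_le_trans ti (le_trans (grid_pt_le ij) jt); rewrite ltxx.
Qed.

Lemma grid_cell_sub i : (i < p)%N -> B i `<=` U.
Proof.
move=> ip t; rewrite /B /U/= !in_itv/= => /andP[it ti].
by rewrite (le_trans (grid_pt_ge i) it)/= (lt_le_trans ti)// grid_pt_le.
Qed.

Lemma grid_cell_cover t : U t -> exists2 i, (i < p)%N & B i t.
Proof.
rewrite /U/= in_itv/= => /andP[ct]; elim: p => [|q ih] tq.
  by rewrite grid_pt0 in tq; have := lt_le_trans tq ct; rewrite ltxx.
have [tq'|qt] := ltP t (lam q).
  by have [i iq Bi] := ih tq'; exists i => //; exact: ltnW.
by exists q => //; rewrite /B/= in_itv/= qt tq.
Qed.

Lemma grid_step (a : nat -> R) t i : (i < p)%N -> B i t ->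
  \sum_(j < p) a j * \1_(B j) t = a i.
Proof.
move=> ip Bt; rewrite (bigD1 (Ordinal ip))//= indicE mem_set// mulr1.
rewrite big1 ?addr0// => j ji; rewrite indicE memNset ?mulr0// => Bjt.
have : (B j `&` B i) t by split.
by rewrite grid_cell_disj.
Qed.

Lemma ip_cells i j x y : b (P (B i) x) (P (B j) y) = (i == j)%:R * b (P (B i) x) y.
Proof.
rewrite ip_eproj//; have [->|ij] := eqVneq i j; first by rewrite setIid mul1r.
by rewrite grid_cell_disj// (eproj_null _ measurable0)// ?measure0// mul0r.
Qed.

Lemma ip_grid_op a x y : b (L a x) y = \sum_(i < p) a i * b (P (B i) x) y.
Proof. by rewrite ip_suml; apply: eq_bigr => i _; rewrite ipZl. Qed.

Lemma ip_cell_grid_op a i x y : (i < p)%N ->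
  b (P (B i) (L a x)) y = a i * b (P (B i) x) y.
Proof.
move=> ip; rewrite eproj_sym// ip_grid_op (bigD1 (Ordinal ip))//=.
rewrite ip_cells eqxx mul1r big1 ?addr0// => j; rewrite -val_eqE/= => ji.
by rewrite ip_cells (negPf ji) mul0r mulr0.
Qed.

Lemma ip_grid_opM a a' x y :
  b (L a (L a' x)) y = b (L (fun i => a i * a' i) x) y.
Proof.
rewrite !ip_grid_op; apply: eq_bigr => i _.
by rewrite ip_cell_grid_op// mulrA.
Qed.

Lemma grid_op_sym a x y : b (L a x) y = b x (L a y).
Proof.
rewrite ip_grid_op ipC ip_grid_op; apply: eq_bigr => i _.
by rewrite eproj_sym// ipC.
Qed.

Lemma ip_grid_op_lin I (r : seq I) (Q : pred I) (F : I -> V) (d : I -> R) a y :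
  b (L a (\sum_(i <- r | Q i) d i *: F i)) y =
  \sum_(i <- r | Q i) d i * b (L a (F i)) y.
Proof.
rewrite grid_op_sym ip_suml; apply: eq_bigr => i _.
by rewrite ipZl -grid_op_sym.
Qed.

(** [L (fun=> 1)] is a symmetric idempotent, so [u] is also the squared length of [L (fun=> 1) x],
    and Cauchy-Schwarz reads [u ^ 2 <= u * b x x]. *)
Let ip1_le x : b (L (fun=> 1) x) x <= b x x.
Proof.
have h : b (L (fun=> 1) x) (L (fun=> 1) x) = b (L (fun=> 1) x) x.
  by rewrite -grid_op_sym ip_grid_opM; do 2 f_equal; apply/funext => i; rewrite mulr1.
have := ip_sqr_le b (L (fun=> 1) x) x; rewrite h expr2.
have := ip_ge0 b (L (fun=> 1) x); rewrite h.
set u := b (L _ x) x; rewrite le_eqVlt => /predU1P[<- _|u0]; first exact: ip_ge0.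
by rewrite ler_pM2l.
Qed.

Lemma grid_op_le M a x : 0 <= M -> (forall i, `|a i| <= M) ->
  nm b (L a x) <= M * nm b x.
Proof.
move=> M0 aM; apply: nm_le; first by rewrite mulr_ge0 ?nm_ge0.
rewrite exprMn sqr_nm -grid_op_sym ip_grid_opM.
apply: (@le_trans _ _ (M ^+ 2 * b (L (fun=> 1) x) x)); last first.
  by rewrite ler_wpM2l ?sqr_ge0// ip1_le.
rewrite !ip_grid_op mulr_sumr; apply: ler_sum => i _; rewrite mul1r.
rewrite ler_wpM2r//; first by rewrite -ip_eprojxx ?ip_ge0.
by rewrite -expr2 -real_normK ?num_real// lerXn2r ?nnegrE// aM.
Qed.

Lemma grid_op_supp a x : mu (L a x) (~` U) = 0%E.
Proof.
have mUC := measurableC mU.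
rewrite emeasE// eproj_sym// ip_grid_op big1// => i _.
rewrite ip_eproj// (_ : _ `&` _ = set0); last first.
  by apply/disjoints_subset; rewrite setCK; exact: grid_cell_sub.
by rewrite (eproj_null _ measurable0)// ?measure0// mulr0.
Qed.

Lemma grid_op_dom a x : D (L a x).
Proof.
apply: (dom_bounded (K := `|c| + `|lam p|) _ EA mU _ (grid_op_supp a x)) => //.
move=> t; rewrite /U/= in_itv/= => /andP[lt th].
have := ler_norm (lam p); have := ler_norm c => h1 h2.
by have := normr_ge0 c; have := normr_ge0 (lam p); rewrite ler_norml; lra.
Qed.

(** On a cell the spectral variable exceeds the left endpoint by at most [delta]. Admitting every
    [y] in [D] allows the discretisation of the other operator to be inserted. *)
Lemma grid_op_act a x y : D y ->
  `|b (A (L a x)) y - b (L (fun i => lam i * a i) x) y| <=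
  delta * nm b (L a x) * nm b y.
Proof.
move=> Dy.
have mid : measurable_fun setT (fun t : mT => t) by [].
have := @op_approx R V b E _ D A mid EA p B lam U delta (ltW delta_gt0)
  measurable_grid_cell mU _ (L a x) y (grid_op_dom a x) Dy (grid_op_supp a x).
move=> /(_ _)/wrap[].
  move=> t Ut; have [i ip Bt] := grid_cell_cover Ut; rewrite (grid_step _ ip Bt).
  move: Bt; rewrite /B/= in_itv/= grid_ptS => /andP[it ti].
  by rewrite ger0_norm; lra.
rewrite (ip_grid_op (fun i => lam i * a i)).
rewrite (eq_bigr (fun i : 'I_p => (lam i * a i) * b (P (B i) x) y))//.
by move=> i _; rewrite ip_cell_grid_op// mulrA.
Qed.

(** Within a cell, [expR (- (s * t))] changes by a relative error of at most [s * delta], and its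
    value at the left endpoint is at most [expR (s * c)]. *)
Lemma grid_op_semigroup (s : R) (T : V -> V) a x : 0 <= s ->
  op_integral E (fun t => expR (- (s * t))) setT T ->
  nm b (T (L a x) - L (fun i => expR (- (s * lam i)) * a i) x) <=
  s * expR (s * c) * delta * nm b (L a x).
Proof.
move=> s0 ET; have K0 : 0 <= s * expR (s * c) * delta.
  by rewrite !mulr_ge0 ?expR_ge0// ltW.
apply: nm_dual => [|y]; first by rewrite mulr_ge0 ?nm_ge0.
have mphi : measurable_fun setT (fun t : mT => expR (- (s * t))).
  by apply: measurableT_comp => //; apply: measurableT_comp => //; exact: measurable_funM.
have := @op_approx R V b E _ setT T mphi ET p B (fun i => expR (- (s * lam i))) U
  (s * expR (s * c) * delta) K0 measurable_grid_cell mU _ (L a x) y I I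
  (grid_op_supp a x).
move=> /(_ _)/wrap[].
  move=> t Ut; have [i ip Bt] := grid_cell_cover Ut.
  rewrite (grid_step (fun i => expR (- (s * lam i))) ip Bt).
  move: Bt; rewrite /B/= in_itv/= grid_ptS => /andP[it ti].
  have -> : - (s * t) = - (s * (t - lam i)) + - (s * lam i) by ring.
  rewrite expRD -[X in _ - X]mul1r -mulrBl normrM [`|expR _|]ger0_norm ?expR_ge0//.
  rewrite [leRHS]mulrAC ler_pM//; last first.
    by rewrite ler_expR -mulrN ler_wpM2l//; have := grid_pt_ge i; lra.
  have h1 : 0 <= s * (t - lam i) by rewrite mulr_ge0// subr_ge0.
  rewrite ler0_norm; last by rewrite subr_le0 expR_le1; lra.
  have := expR_ge1Dx (- (s * (t - lam i))).
  have : s * (t - lam i) <= s * delta by rewrite ler_wpM2l//; lra.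
  by lra.
rewrite ipBl ip_grid_op.
rewrite (eq_bigr (fun i : 'I_p => expR (- (s * lam i)) * a i * b (P (B i) x) y)).
  exact: (le_trans (ler_norm _)).
by move=> i _; rewrite ip_cell_grid_op// mulrA.
Qed.

Lemma grid_op1_dist x :
  b (x - L (fun=> 1) x) (x - L (fun=> 1) x) = b x x - fine (mu x U).
Proof.
have h : b (L (fun=> 1) x) (L (fun=> 1) x) = b (L (fun=> 1) x) x.
  by rewrite -grid_op_sym ip_grid_opM; do 2 f_equal; apply/funext => i; rewrite mulr1.
rewrite !(ipBl, ipBr) h (ipC b x); suff -> : fine (mu x U) = b (L (fun=> 1) x) x by ring.
have -> : U = \big[setU/set0]_(i < p) B i.
  rewrite -bigcup_mkord; apply/seteqP; split => t.
    by move=> /grid_cell_cover[i ip Bt]; exists i.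
  by move=> [i /= ip Bt]; exact: grid_cell_sub Bt.
rewrite measure_bigsetU//=; last first.
  apply/trivIsetP => i j _ _ ij; exact: grid_cell_disj.
rewrite (eq_bigr (fun i : 'I_p => (b (P (B i) x) x)%:E)); last first.
  by move=> i _; rewrite emeasE.
by rewrite sumEFin/= ip_grid_op; apply: eq_bigr => i _; rewrite mul1r.
Qed.

End grid.

(** The sets [U p] exhaust [[- c, +oo[], which carries all of the spectral measure of [x]. The mass
    left out is the squared distance, and it tends to zero by continuity from below. *)
Lemma grid_op1_near (R : realType) (V : lmodType R) (b : semi_inner V)
    (E : spectral_family b) (D : set V) (A : V -> V) (c delta eta : R) x :
  op_integral E (fun t => t) D A ->
  (forall x, D x -> - c * b x x <= b (A x) x) -> 0 < delta -> 0 < eta ->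
  \forall p \near \oo, nm b (x - grid_op E c p delta (fun=> 1) x) <= eta.
Proof.
move=> EA A_ge d0 eta0.
pose U p : set (measurableTypeR R) := `[- c, grid_pt c delta p[%classic.
have mU p : measurable (U p) by exact: measurable_itv.
have UE : \bigcup_p U p = `[- c, +oo[%classic.
  apply/seteqP; split => t; first by move=> [p _]; rewrite /U/= !in_itv/= => /andP[->].
  rewrite /= in_itv/= andbT => ct.
  exists (Num.truncn ((t + c) / delta)).+1 => //; rewrite /U/= in_itv/= ct/=.
  have := truncnS_gt ((t + c) / delta); rewrite ltr_pdivrMr//.
  by rewrite /grid_pt; lra.
have cU : fine (emeas E x (U p)) @[p --> \oo] --> b x x.
  apply: fine_cvg.
  have -> : (b x x)%:E = emeas E x (\bigcup_p U p).
    rewrite UE -(emeasT E) -(setvU `[- c, +oo[%classic) measureU//=; last first.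
    - by rewrite setICl.
    - exact: measurableC.
    by rewrite (emeas_belowC EA A_ge) add0e.
  apply: nondecreasing_cvg_mu => //; first exact: bigcupT_measurable.
  move=> p q pq; apply/subsetPset => t; rewrite /U/= !in_itv/= => /andP[->]/=.
  by move=> /lt_le_trans; apply; rewrite grid_pt_le.
near=> p.
apply: nm_le; first exact: ltW.
rewrite grid_op1_dist//; apply: (le_trans (ler_norm _)); apply: ltW.
near: p; move/cvgrPdist_lt : cU; apply.
by rewrite exprn_gt0.
Unshelve. all: by end_near. Qed.

(* No measurability is needed: the integral of a nonnegative function is the
   supremum of the integrals of the simple functions below it. *)
Lemma ge0_integral_mono d (T : measurableType d) (R : realType)
    (mu : {measure set T -> \bar R}) (D : set T) (f g : T -> \bar R) :
  (forall x, D x -> (0 <= f x)%E) -> (forall x, D x -> (f x <= g x)%E) ->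
  (\int[mu]_(x in D) f x <= \int[mu]_(x in D) g x)%E.
Proof.
move=> f0 fg; have g0 x : D x -> (0 <= g x)%E.
  by move=> Dx; apply: le_trans (f0 x Dx) (fg x Dx).
rewrite (ge0_integralE _ f0) (ge0_integralE _ g0).
apply: le_ereal_sup => _ [h hf <-]; exists h => // x.
apply: le_trans (hf x) _; rewrite /patch; case: ifPn => //.
by rewrite inE; exact: fg.
Qed.

(** * Variation of continuously differentiable functions *)

Section continuously_differentiable.
Context (R : realType).
Implicit Types (G g h : R -> R).

Lemma is_derive_continuous G (s df : R) :
  is_derive s 1 G df -> {for s, continuous G}.
Proof. by case=> dG _; apply/differentiable_continuous/derivable1_diffP. Qed.

Definition C1 G g := (forall s : R, is_derive s 1 G (g s)) /\ continuous g.

Lemma C1_expR (a d : R) :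
  C1 (fun s => expR (a * s + d)) (fun s => a * expR (a * s + d)).
Proof.
have Da (s : R) : is_derive s 1 (fun s => a * s + d) a.
  have -> : (fun s => a * s + d) = (a \*: @id R + cst d) by [].
  by apply: is_derive_eq; rewrite addr0 [LHS]mulr1.
have De (s : R) : is_derive s 1 (fun s => expR (a * s + d)) (a * expR (a * s + d)).
  rewrite [X in is_derive _ _ _ X]mulrC.
  exact: (is_derive1_comp (is_derive_expR _) (Da s)).
split => // s; apply: cvgM; first exact: cvg_cst.
exact: is_derive_continuous (De s).
Qed.

Lemma C1_scale (a : R) G g : C1 G g -> C1 (fun s => a * G s) (fun s => a * g s).
Proof.
move=> [DG cg]; split => s; last by apply: cvgM; [exact: cvg_cst|exact: cg].
exact: (is_deriveZ a (DG s)).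
Qed.

Lemma C1_add G1 g1 G2 g2 : C1 G1 g1 -> C1 G2 g2 ->
  C1 (fun s => G1 s + G2 s) (fun s => g1 s + g2 s).
Proof.
move=> [D1 c1] [D2 c2]; split => s; last by apply: cvgD; [exact: c1|exact: c2].
exact: (is_deriveD (D1 s) (D2 s)).
Qed.

Lemma C1_cst (a : R) : C1 (fun=> a) (fun=> 0).
Proof. by split => s; [exact: is_derive_cst|exact: cvg_cst]. Qed.

Lemma C1_sum n (G g : nat -> R -> R) : (forall i, C1 (G i) (g i)) ->
  C1 (fun s => \sum_(i < n) G i s) (fun s => \sum_(i < n) g i s).
Proof.
move=> Gg; elim: n => [|n ih].
  have -> : (fun s => \sum_(i < 0) G i s) = (fun=> 0).
    by apply/funext => s; rewrite big_ord0.
  have -> : (fun s => \sum_(i < 0) g i s) = (fun=> 0).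
    by apply/funext => s; rewrite big_ord0.
  exact: C1_cst.
have -> : (fun s => \sum_(i < n.+1) G i s) = (fun s => \sum_(i < n) G i s + G n s).
  by apply/funext => s; rewrite big_ord_recr.
have -> : (fun s => \sum_(i < n.+1) g i s) = (fun s => \sum_(i < n) g i s + g n s).
  by apply/funext => s; rewrite big_ord_recr.
exact: C1_add.
Qed.

Lemma C1_shift (a : R) G g : C1 G g ->
  C1 (fun s => G (a + s)) (fun s => g (a + s)).
Proof.
move=> [DG cg]; have Da (s : R) : is_derive s 1 (fun s => a + s) 1.
  have -> : (fun s => a + s) = (cst a + @id R) by [].
  by apply: is_derive_eq; rewrite add0r.
split => s.
  rewrite -[X in is_derive _ _ _ X]mulr1.
  exact: (is_derive1_comp (DG _) (Da s)).
apply: (@continuous_comp _ _ _ (fun s => a + s) g); last exact: cg.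
exact: is_derive_continuous (Da s).
Qed.

Lemma C1_variation G g (a b : R) : a < b -> C1 G g ->
  (`|G b - G a|%:E <= \int[@lebesgue_measure R]_(s in `[a, b]) `|g s|%:E)%E.
Proof.
move=> ab [DG cg].
have cgab : {within `[a, b], continuous g} by exact: continuous_subspaceT.
have cG : continuous G.
  by move=> s; exact: is_derive_continuous (DG s).
have -> : `|G b - G a|%:E = `|\int[@lebesgue_measure R]_(s in `[a, b]) (g s)%:E|%E.
  rewrite (@continuous_FTC2 _ g G)//.
  - split => [s _||]; first by case: (DG s).
    + by apply: cvg_at_right_filter; exact: cG.
    + by apply: cvg_at_left_filter; exact: cG.
  - by move=> s _; rewrite derive1E; apply: derive_val.
apply: le_abse_integral => //; apply/measurable_EFinP.
exact: measurable_funTS (continuous_measurable_fun cg).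
Qed.

(** [G1] and [G2] stand for the two halves of the time interval. The function [h] will be an
    operator norm depending on time, whose measurability is not established, so [a * h + eta] is not
    integrated termwise; linearity of the integral is applied to a measurable function below [h]. *)
Lemma C1_variation_le G1 g1 G2 g2 h (t a eta : R) : 0 < t -> 0 <= a -> 0 <= eta ->
  C1 G1 g1 -> C1 G2 g2 ->
  (forall s, 0 <= s <= t -> 0 <= h s /\ `|g1 s| + `|g2 s| <= a * h s + eta) ->
  ((`|G1 t - G1 0| + `|G2 t - G2 0|)%:E <=
   a%:E * \int[@lebesgue_measure R]_(s in `[0%R, t]) (h s)%:E + (eta * t)%:E)%E.
Proof.
move=> t0 a0 eta0 C1G1 C1G2 bound.
pose I : set R := `[0, t]%classic.
have mI : measurable I by exact: measurable_itv.
have mg G g : C1 G g -> measurable_fun I (fun s => `|g s|).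
  move=> [_ cg]; apply: measurableT_comp => //.
  exact: measurable_funTS (continuous_measurable_fun cg).
have mg1 := mg _ _ C1G1; have mg2 := mg _ _ C1G2.
apply: (@le_trans _ _ (\int[@lebesgue_measure R]_(s in I) (`|g1 s| + `|g2 s|)%:E)%E).
  under eq_integral do rewrite EFinD.
  rewrite ge0_integralD//=; [|exact/measurable_EFinP..].
  by rewrite EFinD leeD// C1_variation.
have It : lebesgue_measure I = t%:E.
  by rewrite lebesgue_measure_itv/= lte_fin t0 oppr0 adde0.
have [a_eq0|aN0] := eqVneq a 0.
  apply: (@le_trans _ _ (\int[@lebesgue_measure R]_(s in I) (cst eta%:E s))%E).
    apply: ge0_integral_mono => s; rewrite /I/= in_itv/= => st.
      by rewrite lee_fin addr_ge0.
    by have [_] := bound s st; rewrite a_eq0 mul0r add0r lee_fin.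
  by rewrite integral_cst// [X in (_ * X)%E](_ : _ = t%:E)// a_eq0 mul0e add0e.
have a_gt0 : 0 < a by rewrite lt_neqAle eq_sym aN0.
(* The least nonnegative [q] with [|g1| + |g2| <= a * q + eta]; it is measurable and, on [[0, t]],
   below [h]. *)
pose q s := Num.max 0 ((`|g1 s| + `|g2 s| - eta) / a).
have q0 s : 0 <= q s by rewrite le_max lexx.
have mq : measurable_fun I q.
  apply: measurable_maxr => //; apply: measurable_funM => //.
  by apply: measurable_funB => //; exact: measurable_funD.
apply: (@le_trans _ _ (\int[@lebesgue_measure R]_(s in I) (a%:E * (q s)%:E + eta%:E))%E).
  apply: ge0_integral_mono => s _; first by rewrite lee_fin addr_ge0.
  rewrite -EFinM -EFinD lee_fin -lerBlDr -ler_pdivrMl// mulrC.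
  by rewrite le_max lexx orbT.
rewrite ge0_integralD//=; first last.
- by apply: measurable_funeM; exact/measurable_EFinP.
- by move=> s _; rewrite mule_ge0// lee_fin.
rewrite ge0_integralZl//=; first last.
- by move=> s _; rewrite lee_fin.
- exact/measurable_EFinP.
rewrite integral_cst//= [X in (_ + _ * X)%E](_ : _ = t%:E)//.
apply: leeD => //; apply: lee_wpmul2l => //.
apply: ge0_integral_mono => s; first by rewrite lee_fin.
rewrite /I/= in_itv/= => /bound[h0]; rewrite lee_fin /q ge_max h0/= => gh.
by rewrite ler_pdivrMr//; lra.
Qed.

End continuously_differentiable.

(** * Duhamel's formula for the discretised semigroups *)

Section discretised_duhamel.
Context (R : realType) (V : lmodType R) (b : semi_inner V)
  (E F : spectral_family b) (D : set V) (H A W : V -> V) (T S : R -> V -> V)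
  (c : R).
Hypotheses (c_ge0 : 0 <= c)
  (EH : op_integral E (fun t => t) D H)
  (FA : op_integral F (fun t => t) D A)
  (H_ge0 : forall x, D x -> 0 <= b (H x) x)
  (AE : forall x y, D x -> b (A x) y = b (H x) y + b (W x) y)
  (W_sym : forall x y, b (W x) y = b x (W y))
  (W_le : forall x, nm b (W x) <= c * nm b x)
  (ET : forall s : R, 0 <= s ->
    op_integral E (fun t => expR (- (s * t))) setT (T s))
  (FS : forall s : R, 0 <= s ->
    op_integral F (fun t => expR (- (s * t))) setT (S s)).
Local Notation nm := (nm b).

Lemma H_ge x : D x -> - 0 * b x x <= b (H x) x.
Proof. by move=> /H_ge0; rewrite oppr0 mul0r. Qed.

Lemma A_ge x : D x -> - c * b x x <= b (A x) x.
Proof.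
move=> Dx; rewrite AE//; have := H_ge0 Dx.
have := cauchy_schwarz b (W x) x; rewrite ler_norml => /andP[+ _].
have := ler_wpM2r (nm_ge0 b x) (W_le x); rewrite -mulrA -expr2 sqr_nm.
by lra.
Qed.

Context (p : nat) (delta : R) (delta_gt0 : 0 < delta).
Local Notation lam := (grid_pt 0 delta).
Local Notation mu := (grid_pt c delta).

(** The grid of [H] starts at 0 and that of [A] at [- c], the lower bounds of the two forms. Cutting
    off at the [p]-th grid point puts both images into the common domain [D]. *)
Definition fdisc (r : R) (x : V) :=
  grid_op E 0 p delta (fun i => expR (- (r * lam i))) x.
Definition gdisc (r : R) (x : V) :=
  grid_op F c p delta (fun i => expR (- (r * mu i))) x.

Lemma fdisc_dom r x : D (fdisc r x). Proof. exact: (grid_op_dom 0 EH p delta_gt0). Qed.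
Lemma gdisc_dom r x : D (gdisc r x). Proof. exact: (grid_op_dom c FA p delta_gt0). Qed.
Hint Resolve fdisc_dom gdisc_dom : core.

Lemma lam_ge0 i : 0 <= lam i.
Proof. by have := grid_pt_ge 0 delta_gt0 i; rewrite oppr0. Qed.

Lemma fdisc_le r x : 0 <= r -> nm (fdisc r x) <= nm x.
Proof.
move=> r0; rewrite -[leRHS]mul1r; apply: grid_op_le => // i.
by rewrite ger0_norm ?expR_ge0// expR_le1 oppr_le0 mulr_ge0// lam_ge0.
Qed.

Lemma gdisc_le r x : 0 <= r -> nm (gdisc r x) <= expR (r * c) * nm x.
Proof.
move=> r0.
apply: (grid_op_le F c p delta_gt0 x (expR_ge0 (r * c))) => i.
 rewrite ger0_norm ?expR_ge0// ler_expR -mulrN ler_wpM2l//.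
by have := grid_pt_ge c delta_gt0 i; lra.
Qed.

Lemma fdisc_add s r x : 0 <= s -> 0 <= r ->
  nm (T s (fdisc r x) - fdisc (s + r) x) <= s * delta * nm x.
Proof.
move=> s0 r0; have := grid_op_semigroup 0 p delta_gt0
  (fun i => expR (- (r * lam i))) x s0 (ET s0).
rewrite (_ : (fun i => expR (- (s * lam i)) * expR (- (r * lam i))) =
             (fun i => expR (- ((s + r) * lam i)))); last first.
  by apply/funext => i; rewrite -expRD; congr expR; ring.
move=> /le_trans; apply; rewrite mulr0 expR0 mulr1.
by rewrite ler_wpM2l ?fdisc_le// mulr_ge0// ltW.
Qed.

Lemma gdisc_add s r x : 0 <= s -> 0 <= r ->
  nm (S s (gdisc r x) - gdisc (s + r) x) <=
  s * expR (s * c) * delta * (expR (r * c) * nm x).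
Proof.
move=> s0 r0; have := grid_op_semigroup c p delta_gt0
  (fun i => expR (- (r * mu i))) x s0 (FS s0).
rewrite (_ : (fun i => expR (- (s * mu i)) * expR (- (r * mu i))) =
             (fun i => expR (- ((s + r) * mu i)))); last first.
  by apply/funext => i; rewrite -expRD; congr expR; ring.
move=> /le_trans; apply.
by rewrite ler_wpM2l ?gdisc_le// !mulr_ge0 ?expR_ge0// ltW.
Qed.

Lemma fdisc0 x : fdisc 0 x = grid_op E 0 p delta (fun=> 1) x.
Proof. by congr grid_op; apply/funext => i; rewrite mul0r oppr0 expR0. Qed.

Lemma gdisc0 x : gdisc 0 x = grid_op F c p delta (fun=> 1) x.
Proof. by congr grid_op; apply/funext => i; rewrite mul0r oppr0 expR0. Qed.

Lemma fdisc_bessel r K (e : nat -> V) : 0 <= r ->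
  bessel b 1 K e -> bessel b 1 K (fun k => fdisc r (e k)).
Proof.
move=> r0; apply: bessel_comb => // [a y|x]; first exact: ip_grid_op_lin.
by rewrite mul1r fdisc_le.
Qed.

(** The direct bound [expR (s * c)] would lose the actual norm of the semigroup. Comparing [gdisc s]
    with [S s] after [gdisc 0] keeps [h], up to an error of order [delta]. *)
Lemma gdisc_bessel s h K (u : nat -> V) : 0 <= s -> 0 <= h ->
  (forall x, nm (S s x) <= h * nm x) -> bessel b 1 K u ->
  bessel b (h + s * expR (s * c) * delta) K (fun k => gdisc s (u k)).
Proof.
move=> s0 h0 Sh; have eps0 : 0 <= s * expR (s * c) * delta.
  by rewrite !mulr_ge0 ?expR_ge0// ltW.
apply: bessel_comb => // [|a y|x]; [exact: addr_ge0|exact: ip_grid_op_lin|].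
have := gdisc_add x s0 (lexx 0); rewrite addr0 mul0r expR0 mul1r => gS.
apply: (le_trans (nm_le_dist b _ (S s (gdisc 0 x)))); rewrite nmBC mulrDl.
apply: lerD => //; apply: (le_trans (Sh _)); rewrite ler_wpM2l//.
by have := gdisc_le x (lexx 0); rewrite mul0r expR0 mul1r.
Qed.

(** The product rule for [b (fdisc (t - s) x) (gdisc s y)], the discretised generators appearing as
    the weights [lam i] and [mu i]. *)
Definition dpair t x y s :=
  b (grid_op E 0 p delta (fun i => lam i * expR (- ((t - s) * lam i))) x) (gdisc s y) -
  b (fdisc (t - s) x) (grid_op F c p delta (fun i => mu i * expR (- (s * mu i))) y).

Lemma pair_C1 t x y : C1 (fun s => b (fdisc (t - s) x) (gdisc s y)) (dpair t x y).
Proof.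
pose k i l := b (eproj E (grid_cell 0 delta i) x) (eproj F (grid_cell c delta l) y).
have pairE a a' : b (grid_op E 0 p delta a x) (grid_op F c p delta a' y) =
    \sum_(i < p) \sum_(l < p) a i * a' l * k i l.
  rewrite ip_grid_op; apply: eq_bigr => i _; rewrite ipC ip_grid_op mulr_sumr.
  by apply: eq_bigr => l _; rewrite mulrA (ipC b (eproj F _ _)).
have -> : (fun s => b (fdisc (t - s) x) (gdisc s y)) = (fun s =>
    \sum_(i < p) \sum_(l < p)
      k i l * expR ((lam i - mu l) * s + - (t * lam i))).
  apply/funext => s; rewrite pairE; apply: eq_bigr => i _; apply: eq_bigr => l _.
  by rewrite mulrC -expRD; congr (_ * expR _); ring.
have -> : dpair t x y = (fun s => \sum_(i < p) \sum_(l < p)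
      k i l * ((lam i - mu l) * expR ((lam i - mu l) * s + - (t * lam i)))).
  apply/funext => s; rewrite /dpair !pairE -sumrB; apply: eq_bigr => i _.
  rewrite -sumrB; apply: eq_bigr => l _.
  have -> : (lam i - mu l) * s + - (t * lam i) = - ((t - s) * lam i) + - (s * mu l) by ring.
  by rewrite expRD; ring.
apply: (@C1_sum R p
  (fun i s => \sum_(l < p) k i l * expR ((lam i - mu l) * s + - (t * lam i)))
  (fun i s => \sum_(l < p)
    k i l * ((lam i - mu l) * expR ((lam i - mu l) * s + - (t * lam i))))) => i.
apply: (@C1_sum R p
  (fun l s => k i l * expR ((lam i - mu l) * s + - (t * lam i)))
  (fun l s =>
    k i l * ((lam i - mu l) * expR ((lam i - mu l) * s + - (t * lam i))))) => l.
by apply: C1_scale; exact: C1_expR.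
Qed.

(** With both [f] and [g] in [D], each discretised generator may be replaced by the true one at the
    cost of [delta], whence the factor 2. What remains is [b (H f) g - b f (A g) = - b (W g) f]. *)
Lemma pair_deriv t x y s : 0 <= s -> s <= t ->
  `|dpair t x y s + b (W (gdisc s y)) (fdisc (t - s) x)| <=
  2 * delta * nm x * (expR (s * c) * nm y).
Proof.
move=> s0 st; have ts0 : 0 <= t - s by rewrite subr_ge0.
set f := fdisc (t - s) x; set g := gdisc s y.
have Df : D f by exact: fdisc_dom.
have Dg : D g by exact: gdisc_dom.
have h1 := grid_op_act 0 EH p delta_gt0 (fun i => expR (- ((t - s) * lam i))) x Dg.
have h2 := grid_op_act c FA p delta_gt0 (fun i => expR (- (s * mu i))) y Df.
rewrite -/(fdisc _ _) -/f in h1; rewrite -/(gdisc _ _) -/g in h2.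
have e1 : b (H f) g = b (A g) f - b (W g) f by rewrite AE// (op_sym EH)// ipC; ring.
rewrite /dpair -/f -/g (ipC b f).
have fg : nm f * nm g <= nm x * (expR (s * c) * nm y).
  by apply: ler_pM; [exact: nm_ge0|exact: nm_ge0|exact: fdisc_le|exact: gdisc_le].
have := ler_wpM2l (ltW delta_gt0) fg.
move: h1 h2; rewrite e1 !ler_norml => /andP[h1 h2] /andP[h3 h4] h5.
by apply/andP; split; lra.
Qed.

Lemma T_le s x : 0 <= s -> nm (T s x) <= nm x.
Proof.
move=> s0; have := semigroup_bound EH H_ge x s0 (ET s0).
by rewrite mulr0 expR0 mul1r.
Qed.

Lemma S_le s x : 0 <= s -> nm (S s x) <= expR (s * c) * nm x.
Proof. by move=> s0; exact: (semigroup_bound FA A_ge x s0 (FS s0)). Qed.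

Context (t0 kappa1 kappa2 : R) (h : R -> R).
Hypotheses (t0_gt0 : 0 < t0) (kappa1_ge0 : 0 <= kappa1) (kappa2_ge0 : 0 <= kappa2)
  (T_hs : forall r K f, 0 < r -> bessel b r K f ->
    \sum_(k < K) b (W (T t0 (f k))) (W (T t0 (f k))) <= (kappa1 * r) ^+ 2)
  (S_hs : forall r K f, 0 < r -> bessel b r K f ->
    \sum_(k < K) b (W (S t0 (f k))) (W (S t0 (f k))) <= (kappa2 * r) ^+ 2)
  (h_ge0 : forall s, 0 <= s <= t0 -> 0 <= h s)
  (S_h : forall s x, 0 <= s <= t0 -> nm (S s x) <= h s * nm x).
Local Notation M := (expR (2 * t0 * c)).

Lemma expR_le_M s : s <= 2 * t0 -> expR (s * c) <= M.
Proof. by move=> st; rewrite ler_expR ler_wpM2r. Qed.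

Lemma M_ge1 : 1 <= M.
Proof. by rewrite -expR0 ler_expR !mulr_ge0// ltW. Qed.

(** [fdisc (2 * t0) x] is close to [T (2 * t0) (fdisc 0 x)], which is close to [T (2 * t0) x]
    because [fdisc 0 x] is close to [x]; the same holds for [gdisc] and [S]. *)
Lemma endpoint_error x y : nm x <= 1 -> nm y <= 1 ->
  nm (x - fdisc 0 x) <= delta -> nm (y - gdisc 0 y) <= delta ->
  `|(b (fdisc (2 * t0) x) (gdisc 0 y) - b (fdisc 0 x) (gdisc (2 * t0) y)) -
    (b (T (2 * t0) x) y - b x (S (2 * t0) y))| <=
  delta * (4 * (t0 + 1) * M).
Proof.
move=> x1 y1 xd yd; have M1 := M_ge1.
have tt0 : 0 <= 2 * t0 by rewrite mulr_ge0// ltW.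
have M0 : 0 <= M by exact: expR_ge0.
have fT : nm (fdisc (2 * t0) x - T (2 * t0) x) <= (2 * t0 + 1) * delta.
  rewrite -(subrKA (T (2 * t0) (fdisc 0 x))); apply: (le_trans (nmD _ _ _)).
  have -> : (2 * t0 + 1) * delta = 2 * t0 * delta + delta by ring.
  apply: lerD.
    rewrite nmBC; have := fdisc_add x tt0 (lexx 0); rewrite addr0.
    move=> /le_trans; apply; rewrite ler_piMr// mulr_ge0// ltW//.
  apply: le_trans xd; rewrite (nmBC _ x) -[leRHS]mul1r; apply: op_dist => //.
    by move=> z w; rewrite (op_sym (ET tt0)).
  by move=> z; rewrite mul1r T_le.
have gS : nm (gdisc (2 * t0) y - S (2 * t0) y) <= (2 * t0 + 1) * M * delta.
  rewrite -(subrKA (S (2 * t0) (gdisc 0 y))); apply: (le_trans (nmD _ _ _)).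
  have -> : (2 * t0 + 1) * M * delta = 2 * t0 * M * delta + M * delta by ring.
  apply: lerD.
    rewrite nmBC; have := gdisc_add y tt0 (lexx 0); rewrite addr0.
    move=> /le_trans; apply; rewrite mul0r expR0 mul1r.
    by rewrite ler_piMr// !mulr_ge0// ltW.
  apply: (@le_trans _ _ (M * nm (gdisc 0 y - y))); last first.
    by rewrite ler_wpM2l// nmBC.
  apply: op_dist => //; first by move=> z w; rewrite (op_sym (FS tt0)).
  by move=> z; exact: S_le.
have f0 : nm (fdisc 0 x) <= 1 by apply: le_trans x1; exact: fdisc_le.
have g0 : nm (gdisc 0 y) <= 1.
  by apply: le_trans y1; have := gdisc_le y (lexx 0); rewrite mul0r expR0 mul1r.
have Tx : nm (T (2 * t0) x) <= 1 by apply: le_trans x1; exact: T_le.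
have gM : nm (gdisc (2 * t0) y) <= M.
  by apply: (le_trans (gdisc_le _ tt0)); rewrite ler_piMr.
have e1 : `|b (fdisc (2 * t0) x) (gdisc 0 y) - b (T (2 * t0) x) y| <=
    (2 * t0 + 1) * delta + delta.
  apply: (le_trans (ip_dist _ _ _ _ _)); apply: lerD.
    by rewrite -[leRHS]mulr1; apply: ler_pM => //; exact: nm_ge0.
  by rewrite -[leRHS]mul1r; apply: ler_pM; rewrite ?nm_ge0// nmBC.
have e2 : `|b (fdisc 0 x) (gdisc (2 * t0) y) - b x (S (2 * t0) y)| <=
    delta * M + (2 * t0 + 1) * M * delta.
  apply: (le_trans (ip_dist _ _ _ _ _)); apply: lerD.
    by apply: ler_pM; rewrite ?nm_ge0// nmBC.
  by rewrite -[leRHS]mul1r; apply: ler_pM; rewrite ?nm_ge0.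
move: e1 e2; rewrite !ler_norml => /andP[e1 e2] /andP[e3 e4].
(* The two errors are [2 * t0 + 2] and [(2 * t0 + 2) * M] times [delta]; [M >= 1] merges them into
   [4 * (t0 + 1) * M]. *)
have : 0 <= (M - 1) * delta * (2 * t0 + 2).
  by rewrite !mulr_ge0 ?subr_ge0// ?addr_ge0// ltW.
move=> e5; apply/andP; split; lra.
Qed.

Context (J K : nat) (e u : nat -> V) (C : nat -> nat -> R).
Hypotheses (e_on : orthonormal_family b J e) (u_on : orthonormal_family b K u).
Local Notation nC := (Num.sqrt (\sum_(j < J) \sum_(k < K) C j k ^+ 2)).
Local Notation sC := (\sum_(j < J) \sum_(k < K) `|C j k|).
(** A Bessel bound of the family [gdisc s (u k)]. It is positive even where [h] vanishes, as [S_hs]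
    requires. *)
Let r s := h s + t0 * M * delta.
Let dG s := \sum_(j < J) \sum_(k < K) C j k * dpair (2 * t0) (e j) (u k) s.

Lemma sum_error (c1 c2 : nat -> nat -> R) eps : (forall j k, (j < J)%N -> (k < K)%N ->
    `|c1 j k - c2 j k| <= eps) ->
  `|\sum_(j < J) \sum_(k < K) C j k * c1 j k -
    \sum_(j < J) \sum_(k < K) C j k * c2 j k| <= eps * sC.
Proof.
move=> cc; rewrite -sumrB mulr_sumr; apply: (le_trans (ler_norm_sum _ _ _)).
apply: ler_sum => j _; rewrite -sumrB mulr_sumr.
apply: (le_trans (ler_norm_sum _ _ _)); apply: ler_sum => k _.
by rewrite -mulrBr normrM mulrC ler_wpM2r// cc.
Qed.

Let nC_ge0 : 0 <= nC. Proof. exact: sqrtr_ge0. Qed.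

Let r_gt0 s : 0 <= s <= t0 -> 0 < r s.
Proof. by move=> /h_ge0 hs; rewrite ltr_wpDl// !mulr_gt0// expR_gt0. Qed.

Let gdisc_bessel_r s : 0 <= s <= t0 -> bessel b (r s) K (fun k => gdisc s (u k)).
Proof.
move=> st; have /andP[s0 s1] := st.
apply: (bessel_mono _ _ (gdisc_bessel s0 (h_ge0 st) (fun x => S_h x st)
  (bessel_orthonormal u_on))).
  by rewrite addr_ge0 ?h_ge0// !mulr_ge0 ?expR_ge0// ltW.
rewrite lerD2l ler_wpM2r//; first exact: ltW.
by apply: ler_pM => //; apply: expR_le_M; lra.
Qed.

(** [fdisc (2 * t0 - s)] is replaced by [T t0] after [fdisc (t0 - s)], so that [T_hs] applies to the
    [e j] and the Bessel bound [r s] to the [u k]. In the error, [2 * M] comes from [pair_deriv] and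
    [c * t0 * M] from this replacement. *)
Lemma dG_first s : 0 <= s <= t0 ->
  `|dG s| <= kappa1 * nC * r s + delta * (2 * M + c * t0 * M) * sC.
Proof.
move=> st; have /andP[s0 s1] := st; have M0 : 0 <= M by exact: expR_ge0.
have tt0 : 0 <= t0 - s by rewrite subr_ge0.
pose f j := fdisc (t0 - s) (e j); pose g k := gdisc s (u k).
have bf : bessel b 1 J f by apply: fdisc_bessel => //; exact: bessel_orthonormal.
have main := bessel_pairing J (fun j => W (T t0 (f j))) C (ltW (r_gt0 st)) (gdisc_bessel_r st).
have pt j k : (j < J)%N -> (k < K)%N ->
    `|dpair (2 * t0) (e j) (u k) s - - b (W (T t0 (f j))) (g k)| <=
    delta * (2 * M + c * t0 * M).
  move=> jJ kK.
  have x1 := nm_orthonormal e_on jJ; have y1 := nm_orthonormal u_on kK.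
  have h1 := pair_deriv (e j) (u k) s0 (_ : s <= 2 * t0).
  have {}h1 := h1 ltac:(lra).
  have gM : nm (g k) <= M.
    apply: (le_trans (gdisc_le _ s0)); rewrite y1 mulr1.
    by apply: expR_le_M; lra.
  have h2 := fdisc_add (e j) (ltW t0_gt0) tt0.
  have e1 : t0 + (t0 - s) = 2 * t0 - s by ring.
  rewrite e1 x1 mulr1 nmBC in h2.
  have h3 : `|b (W (g k)) (fdisc (2 * t0 - s) (e j)) - b (W (T t0 (f j))) (g k)| <=
      delta * (c * t0 * M).
    rewrite (ipC b _ (fdisc _ _)) -W_sym -ipBl.
    have -> : b (W (fdisc (2 * t0 - s) (e j)) - W (T t0 (f j))) (g k) =
              b (fdisc (2 * t0 - s) (e j) - T t0 (f j)) (W (g k)).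
      by rewrite ipBl !W_sym -ipBl.
    apply: (le_trans (cauchy_schwarz _ _ _)).
    apply: (@le_trans _ _ (t0 * delta * (c * M))); last first.
      by rewrite le_eqVlt; apply/orP; left; apply/eqP; ring.
    apply: ler_pM; [exact: nm_ge0|exact: nm_ge0|exact: h2|].
    by apply: (le_trans (W_le _)); rewrite ler_wpM2l.
  have eM : expR (s * c) <= M by apply: expR_le_M; lra.
  have h4 := ler_wpM2l (ltW delta_gt0) eM.
  move: h1 h3; rewrite x1 y1 !mulr1 !ler_norml => /andP[h5 h6] /andP[h7 h8].
  by rewrite -/(g k) in h5 h6; apply/andP; split; lra.
have yJ : Num.sqrt (\sum_(j < J) b (W (T t0 (f j))) (W (T t0 (f j)))) <= kappa1.
  rewrite -[leRHS](ger0_norm kappa1_ge0) -sqrtr_sqr ler_wsqrtr//.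
  by have := T_hs ltr01 bf; rewrite mulr1.
have /= := sum_error pt.
have negE : \sum_(j < J) \sum_(k < K) C j k * - b (W (T t0 (f j))) (g k) =
    - \sum_(j < J) \sum_(k < K) C j k * b (W (T t0 (f j))) (g k).
  rewrite -sumrN; apply: eq_bigr => j _; rewrite -sumrN.
  by apply: eq_bigr => k _; rewrite mulrN.
rewrite negE opprK => err; rewrite -[dG s](addrK (\sum_(j < J) \sum_(k < K)
  C j k * b (W (T t0 (f j))) (g k))); apply: (le_trans (ler_normB _ _)).
rewrite addrC; apply: lerD => //; apply: (le_trans main).
rewrite (_ : kappa1 * nC * r s = r s * kappa1 * nC); last by ring.
by rewrite ler_wpM2r ?nC_ge0// ler_wpM2l// ltW// r_gt0.
Qed.

(** The mirror image: [gdisc (t0 + s)] is replaced by [S t0] after [gdisc s], whose Bessel bound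
    [r s] enters [S_hs]. The replacement now costs two growth factors, one from [S t0] and one from
    [gdisc s], hence [M * M]. *)
Lemma dG_second s : 0 <= s <= t0 ->
  `|dG (t0 + s)| <= kappa2 * nC * r s + delta * (2 * M + c * t0 * M * M) * sC.
Proof.
move=> st; have /andP[s0 s1] := st; have M0 : 0 <= M by exact: expR_ge0.
have tt0 : 0 <= t0 - s by rewrite subr_ge0.
pose f j := fdisc (t0 - s) (e j); pose g k := gdisc s (u k).
have bf : bessel b 1 J f by apply: fdisc_bessel => //; exact: bessel_orthonormal.
(* The square-summable family is now indexed by [k], so [C] enters transposed. *)
have main := bessel_pairing K (fun k => W (S t0 (g k))) (fun k j => C j k) ler01 bf.
have pt j k : (j < J)%N -> (k < K)%N ->
    `|dpair (2 * t0) (e j) (u k) (t0 + s) - - b (W (S t0 (g k))) (f j)| <=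
    delta * (2 * M + c * t0 * M * M).
  move=> jJ kK.
  have x1 := nm_orthonormal e_on jJ; have y1 := nm_orthonormal u_on kK.
  have ts0 : 0 <= t0 + s by rewrite addr_ge0// ltW.
  have h1 := pair_deriv (e j) (u k) ts0 (_ : t0 + s <= 2 * t0).
  have {}h1 := h1 ltac:(lra).
  have e1 : 2 * t0 - (t0 + s) = t0 - s by ring.
  rewrite e1 x1 y1 !mulr1 in h1.
  have f1 : nm (f j) <= 1 by rewrite -x1; exact: fdisc_le.
  have sM : expR (s * c) <= M by apply: expR_le_M; lra.
  have h2 := gdisc_add (u k) (ltW t0_gt0) s0.
  rewrite y1 mulr1 nmBC in h2.
  have {}h2 : nm (gdisc (t0 + s) (u k) - S t0 (g k)) <= t0 * M * delta * M.
    apply: (le_trans h2); apply: ler_pM => //.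
    - by rewrite !mulr_ge0 ?expR_ge0// ltW.
    - apply: (ler_wpM2r (ltW delta_gt0)); apply: (ler_wpM2l (ltW t0_gt0)).
      by apply: expR_le_M; lra.
  have h3 : `|b (W (gdisc (t0 + s) (u k))) (f j) - b (W (S t0 (g k))) (f j)| <=
      delta * (c * t0 * M * M).
    rewrite !W_sym -ipBl; apply: (le_trans (cauchy_schwarz _ _ _)).
    apply: (@le_trans _ _ (t0 * M * delta * M * (c * 1))); last first.
      by rewrite le_eqVlt; apply/orP; left; apply/eqP; ring.
    apply: ler_pM; [exact: nm_ge0|exact: nm_ge0|exact: h2|].
    by apply: (le_trans (W_le _)); rewrite ler_wpM2l.
  have eM : expR ((t0 + s) * c) <= M by apply: expR_le_M; lra.
  have h4 := ler_wpM2l (ltW delta_gt0) eM.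
  move: h1 h3; rewrite -/(f j) !ler_norml => /andP[h5 h6] /andP[h7 h8].
  by apply/andP; split; lra.
have yK : Num.sqrt (\sum_(k < K) b (W (S t0 (g k))) (W (S t0 (g k)))) <= kappa2 * r s.
  have k0 : 0 <= kappa2 * r s by rewrite mulr_ge0// ltW// r_gt0.
  rewrite -[leRHS](ger0_norm k0) -sqrtr_sqr ler_wsqrtr//.
  exact: (S_hs (r_gt0 st) (gdisc_bessel_r st)).
have /= := sum_error pt.
have negE : \sum_(j < J) \sum_(k < K) C j k * - b (W (S t0 (g k))) (f j) =
    - \sum_(j < J) \sum_(k < K) C j k * b (W (S t0 (g k))) (f j).
  rewrite -sumrN; apply: eq_bigr => j _; rewrite -sumrN.
  by apply: eq_bigr => k _; rewrite mulrN.
rewrite negE opprK => err; rewrite -[dG _](addrK (\sum_(j < J) \sum_(k < K)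
  C j k * b (W (S t0 (g k))) (f j))); apply: (le_trans (ler_normB _ _)).
rewrite addrC; apply: lerD => //; rewrite exchange_big/=.
apply: (le_trans main); rewrite mul1r exchange_big/=.
by rewrite [leRHS]mulrAC ler_wpM2r ?nC_ge0.
Qed.

Lemma discretised_bound :
  (forall j, (j < J)%N -> nm (e j - fdisc 0 (e j)) <= delta) ->
  (forall k, (k < K)%N -> nm (u k - gdisc 0 (u k)) <= delta) ->
  (`|\sum_(j < J) \sum_(k < K) C j k *
      (b (T (2 * t0) (e j)) (u k) - b (e j) (S (2 * t0) (u k)))|%:E <=
   ((kappa1 + kappa2) * nC)%:E *
     \int[@lebesgue_measure R]_(s in `[0%R, t0]) (h s)%:E +
   (delta * (((kappa1 + kappa2) * nC * (t0 * M) +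
      (4 * M + c * t0 * M + c * t0 * M * M) * sC) * t0 +
      4 * (t0 + 1) * M * sC))%:E)%E.
Proof.
move=> e_near u_near.
have M0 : 0 <= M by exact: expR_ge0.
pose G s := \sum_(j < J) \sum_(k < K)
  C j k * b (fdisc (2 * t0 - s) (e j)) (gdisc s (u k)).
have C1G : C1 G dG.
  apply: (@C1_sum R J
    (fun j s => \sum_(k < K) C j k * b (fdisc (2 * t0 - s) (e j)) (gdisc s (u k)))
    (fun j s => \sum_(k < K) C j k * dpair (2 * t0) (e j) (u k) s)) => j.
  apply: (@C1_sum R K
    (fun k s => C j k * b (fdisc (2 * t0 - s) (e j)) (gdisc s (u k)))
    (fun k s => C j k * dpair (2 * t0) (e j) (u k) s)) => k.
  by apply: C1_scale; exact: pair_C1.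
have nC0 := nC_ge0.
have sC0 : 0 <= sC by apply: sumr_ge0 => j _; apply: sumr_ge0 => k _.
(* Gathers the excess [t0 * M * delta] of [r] over [h] and the pointwise errors of both halves. *)
pose eta := delta * ((kappa1 + kappa2) * nC * (t0 * M) +
      (4 * M + c * t0 * M + c * t0 * M * M) * sC).
have a0 : 0 <= (kappa1 + kappa2) * nC by rewrite mulr_ge0// addr_ge0.
have t00 := ltW t0_gt0.
have eta0 : 0 <= eta.
  rewrite mulr_ge0 ?(ltW delta_gt0)// addr_ge0//.
    by rewrite mulr_ge0// mulr_ge0.
  by rewrite mulr_ge0// !addr_ge0// !mulr_ge0.
(* The second half of the time interval enters through the shifted function [G (t0 + s)], so that
   both halves share [h] on [[0, t0]]. *)
have var := C1_variation_le t0_gt0 a0 eta0 C1G (C1_shift t0 C1G).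
have {}var := var h.
have pt s : 0 <= s <= t0 -> 0 <= h s /\
    `|dG s| + `|dG (t0 + s)| <= (kappa1 + kappa2) * nC * h s + eta.
  move=> st; split; first exact: h_ge0.
  have := lerD (dG_first st) (dG_second st).
  by move=> /le_trans; apply; rewrite /eta /r le_eqVlt; apply/orP; left; apply/eqP; ring.
have {}var := var pt.
have end_err : `|\sum_(j < J) \sum_(k < K) C j k *
      (b (T (2 * t0) (e j)) (u k) - b (e j) (S (2 * t0) (u k))) -
    (G 0 - G (2 * t0))| <= delta * (4 * (t0 + 1) * M) * sC.
  have pe j k : (j < J)%N -> (k < K)%N ->
    `|(b (T (2 * t0) (e j)) (u k) - b (e j) (S (2 * t0) (u k))) -
      (b (fdisc (2 * t0) (e j)) (gdisc 0 (u k)) -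
       b (fdisc 0 (e j)) (gdisc (2 * t0) (u k)))| <= delta * (4 * (t0 + 1) * M).
    move=> jJ kK; rewrite distrC; apply: endpoint_error.
    - by rewrite (nm_orthonormal e_on jJ).
    - by rewrite (nm_orthonormal u_on kK).
    - exact: e_near.
    - exact: u_near.
  have /= := sum_error pe; set X := \sum_(j < J) _; set Y := \sum_(j < J) _.
  suff -> : Y = G 0 - G (2 * t0) by [].
  rewrite /Y /G -sumrB; apply: eq_bigr => j _; rewrite -sumrB.
  by apply: eq_bigr => k _; rewrite mulrBr subr0 subrr.
set X := \sum_(j < J) _ in end_err *.
have XG : `|X| <= `|G t0 - G 0| + `|G (t0 + t0) - G (t0 + 0)| +
    delta * (4 * (t0 + 1) * M) * sC.
  rewrite -(subrK (G 0 - G (2 * t0)) X); apply: (le_trans (ler_normD _ _)).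
  rewrite addrC; apply: lerD => //.
  have -> : G 0 - G (2 * t0) = - (G t0 - G 0) - (G (t0 + t0) - G (t0 + 0)).
    by rewrite addr0 (_ : t0 + t0 = 2 * t0); ring.
  by apply: (le_trans (ler_normB _ _)); rewrite normrN.
apply: (@le_trans _ _ ((`|G t0 - G 0| + `|G (t0 + t0) - G (t0 + 0)|)%:E +
    (delta * (4 * (t0 + 1) * M) * sC)%:E)%E); first by rewrite -EFinD lee_fin.
apply: (le_trans (leeD var (lexx _))); rewrite -addeA leeD// -EFinD lee_fin.
by rewrite /eta le_eqVlt; apply/orP; left; apply/eqP; ring.
Qed.

End discretised_duhamel.

Lemma near_forall_lt N (Q : nat -> nat -> Prop) :
  (forall j, \forall p \near \oo, Q j p) ->
  \forall p \near \oo, forall j, (j < N)%N -> Q j p.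
Proof.
move=> hQ; elim: N => [|N ih]; first exact: nearW.
apply: filterS2 ih (hQ N) => p h1 h2 j; rewrite ltnS leq_eqVlt => /predU1P[->//|].
exact: h1.
Qed.

(** * The Hilbert-Schmidt estimate for finite orthonormal families *)

Section abstract_bound.
Context (R : realType) (V : lmodType R) (b : semi_inner V)
  (E F : spectral_family b) (D : set V) (H A W : V -> V) (T S : R -> V -> V)
  (c : R).
Hypotheses (c_ge0 : 0 <= c)
  (EH : op_integral E (fun t => t) D H)
  (FA : op_integral F (fun t => t) D A)
  (H_ge0 : forall x, D x -> 0 <= b (H x) x)
  (AE : forall x y, D x -> b (A x) y = b (H x) y + b (W x) y)
  (W_sym : forall x y, b (W x) y = b x (W y))
  (W_le : forall x, nm b (W x) <= c * nm b x)
  (ET : forall s : R, 0 <= s ->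
    op_integral E (fun t => expR (- (s * t))) setT (T s))
  (FS : forall s : R, 0 <= s ->
    op_integral F (fun t => expR (- (s * t))) setT (S s)).
Context (t0 kappa1 kappa2 : R) (h : R -> R).
Hypotheses (t0_gt0 : 0 < t0) (kappa1_ge0 : 0 <= kappa1) (kappa2_ge0 : 0 <= kappa2)
  (T_hs : forall r K f, 0 < r -> bessel b r K f ->
    \sum_(k < K) b (W (T t0 (f k))) (W (T t0 (f k))) <= (kappa1 * r) ^+ 2)
  (S_hs : forall r K f, 0 < r -> bessel b r K f ->
    \sum_(k < K) b (W (S t0 (f k))) (W (S t0 (f k))) <= (kappa2 * r) ^+ 2)
  (h_ge0 : forall s, 0 <= s <= t0 -> 0 <= h s)
  (S_h : forall s x, 0 <= s <= t0 -> nm b (S s x) <= h s * nm b x).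
Local Notation Dif x := (T (2 * t0) x - S (2 * t0) x).

Lemma weak_duhamel_bound J K e u (C : nat -> nat -> R) :
  orthonormal_family b J e -> orthonormal_family b K u ->
  (`|\sum_(j < J) \sum_(k < K) C j k * b (Dif (e j)) (u k)|%:E <=
   ((kappa1 + kappa2) * Num.sqrt (\sum_(j < J) \sum_(k < K) C j k ^+ 2))%:E *
     \int[@lebesgue_measure R]_(s in `[0%R, t0]) (h s)%:E)%E.
Proof.
move=> e_on u_on; apply/lee_addgt0Pr => eps eps0.
pose M := expR (2 * t0 * c).
pose sC := \sum_(j < J) \sum_(k < K) `|C j k|.
pose nC := Num.sqrt (\sum_(j < J) \sum_(k < K) C j k ^+ 2).
pose Q := ((kappa1 + kappa2) * nC * (t0 * M) +
      (4 * M + c * t0 * M + c * t0 * M * M) * sC) * t0 +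
      4 * (t0 + 1) * M * sC.
have Q0 : 0 <= Q.
  have M0 : 0 <= M by exact: expR_ge0.
  have sC0 : 0 <= sC by apply: sumr_ge0 => j _; apply: sumr_ge0.
  have nC0 : 0 <= nC by exact: sqrtr_ge0.
  have t00 := ltW t0_gt0.
  by rewrite /Q; repeat (apply: addr_ge0 || apply: mulr_ge0).
(* [Q] does not involve [p], so [delta] can be fixed before [p]; the [+ 1] covers [Q = 0]. *)
pose delta := eps / (Q + 1).
have Q1 : 0 < Q + 1 by rewrite ltr_wpDl.
have delta0 : 0 < delta by rewrite divr_gt0.
have [p [e_near u_near]] : exists p,
    (forall j, (j < J)%N -> nm b (e j - fdisc E p delta 0 (e j)) <= delta) /\
    (forall k, (k < K)%N -> nm b (u k - gdisc F c p delta 0 (u k)) <= delta).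
  have n1 j : \forall p \near \oo, nm b (e j - fdisc E p delta 0 (e j)) <= delta.
    have := grid_op1_near (e j) EH (H_ge H_ge0) delta0 delta0.
    by apply: filterS => p; rewrite fdisc0.
  have n2 k : \forall p \near \oo, nm b (u k - gdisc F c p delta 0 (u k)) <= delta.
    have := grid_op1_near (u k) FA (A_ge H_ge0 AE W_le) delta0 delta0.
    by apply: filterS => p; rewrite gdisc0.
  apply: (@filter_ex _ \oo); apply: filterI; exact: near_forall_lt.
have tt0 : 0 <= 2 * t0 by rewrite mulr_ge0// ltW.
have := discretised_bound c_ge0 EH FA H_ge0 AE W_sym W_le ET FS delta0 t0_gt0
  kappa1_ge0 kappa2_ge0 T_hs S_hs h_ge0 S_h C e_on u_on e_near u_near.
rewrite (_ : \sum_(j < J) \sum_(k < K) _ =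
    \sum_(j < J) \sum_(k < K) C j k * b (Dif (e j)) (u k)); last first.
  apply: eq_bigr => j _; apply: eq_bigr => k _.
  by rewrite ipBl (op_sym (FS tt0)).
move=> /le_trans; apply; apply: leeD => //; rewrite lee_fin -/M -/sC -/nC -/Q.
by rewrite /delta mulrAC ler_pdivrMr// ler_wpM2l ?ltW// ltrDl.
Qed.

(** The coefficients [C j k] are taken to be [b (Dif (e j)) (u k)] themselves: the left side of
    [weak_duhamel_bound] becomes [N ^ 2], its right side contains one factor [N], and [N]
    cancels. *)
Theorem semigroup_difference_hs J e : orthonormal_family b J e ->
  ((Num.sqrt (\sum_(j < J) b (Dif (e j)) (Dif (e j))))%:E <=
   (kappa1 + kappa2)%:E *
     \int[@lebesgue_measure R]_(s in `[0%R, t0]) (h s)%:E)%E.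
Proof.
move=> e_on.
have [K [u [u_on uP]]] := gram_schmidt b [seq Dif (e j) | j <- iota 0 J].
have DE j : (j < J)%N -> b (Dif (e j)) (Dif (e j)) =
    \sum_(k < K) b (Dif (e j)) (u k) ^+ 2.
  by move=> jJ; apply: uP; apply/mapP; exists j => //; rewrite mem_iota.
have := weak_duhamel_bound (fun j k => b (Dif (e j)) (u k)) e_on u_on.
have -> : \sum_(j < J) b (Dif (e j)) (Dif (e j)) =
    \sum_(j < J) \sum_(k < K) b (Dif (e j)) (u k) ^+ 2.
  by apply: eq_bigr => j _; rewrite DE.
rewrite (eq_bigr (fun j : 'I_J => \sum_(k < K) b (Dif (e j)) (u k) ^+ 2)); last first.
  by move=> j _; apply: eq_bigr => k _; rewrite expr2.
set N2 := \sum_(j < J) _; set N := Num.sqrt N2.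
have N20 : 0 <= N2 by apply: sumr_ge0 => j _; apply: sumr_ge0 => k _; exact: sqr_ge0.
have N0 : 0 <= N by exact: sqrtr_ge0.
have int0 : (0 <= \int[@lebesgue_measure R]_(s in `[0%R, t0]) (h s)%:E)%E.
  by apply: integral_ge0 => s /=; rewrite in_itv/= lee_fin; exact: h_ge0.
have [->|Nn0] := eqVneq N 0.
  by move=> _; rewrite mule_ge0// lee_fin addr_ge0.
have NN : N2 = N * N by rewrite -expr2 sqr_sqrtr.
rewrite ger0_norm// [in leLHS]NN EFinM [in leRHS]EFinM -muleA muleCA.
by rewrite lee_pmul2l// lte_fin lt_neqAle eq_sym Nn0.
Qed.

End abstract_bound.

(** * Scalars and vectors over either field, seen as real spaces *)

Section scalars.
Context (R : realType) (k : field_kind).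
Local Notation K := (sfield R k).
Implicit Types (z w : K).

Definition sreal (a : R) : K := smk k a 0.

Lemma sReD z w : sRe (z + w) = sRe z + sRe w.
Proof. by case: k z w => //= -[a b] [c d]. Qed.

Lemma sImD z w : sIm (z + w) = sIm z + sIm w.
Proof. by case: k z w => [z w|[a b] [c d]] //=; rewrite addr0. Qed.

Lemma sReM z w : sRe (z * w) = sRe z * sRe w - sIm z * sIm w.
Proof. by case: k z w => [z w|[a b] [c d]] //=; rewrite mul0r subr0. Qed.

Lemma sImM z w : sIm (z * w) = sRe z * sIm w + sIm z * sRe w.
Proof. by case: k z w => [z w|[a b] [c d]] //=; rewrite mulr0 mul0r addr0. Qed.

Lemma sRe_conj z : sRe (sconj z) = sRe z.
Proof. by case: k z => [z|[a b]]. Qed.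

Lemma sIm_conj z : sIm (sconj z) = - sIm z.
Proof. by case: k z => [z|[a b]] //=; rewrite oppr0. Qed.

Lemma sRe0 : sRe (0 : K) = 0. Proof. by case: k. Qed.
Lemma sIm0 : sIm (0 : K) = 0. Proof. by case: k. Qed.

Lemma sRe_sum I (r : seq I) (P : pred I) (F : I -> K) :
  sRe (\sum_(i <- r | P i) F i) = \sum_(i <- r | P i) sRe (F i).
Proof. exact: (big_morph _ sReD sRe0). Qed.

Lemma sIm_sum I (r : seq I) (P : pred I) (F : I -> K) :
  sIm (\sum_(i <- r | P i) F i) = \sum_(i <- r | P i) sIm (F i).
Proof. exact: (big_morph _ sImD sIm0). Qed.

Lemma sabsE z : sabs z ^+ 2 = sRe z ^+ 2 + sIm z ^+ 2.
Proof.
rewrite /sabs; case: k z => [z|[a b]] /=.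
  by rewrite real_normK ?num_real// expr0n addr0.
by rewrite sqr_sqrtr// addr_ge0 ?sqr_ge0.
Qed.

Lemma sRe_real a : sRe (sreal a) = a. Proof. by rewrite /sreal; case: k. Qed.
Lemma sIm_real a : sIm (sreal a) = 0. Proof. by rewrite /sreal; case: k. Qed.

Lemma scalar_eq z w : sRe z = sRe w -> sIm z = sIm w -> z = w.
Proof. by case: k z w => [z w //|[a b] [c d] /= -> ->]. Qed.

Lemma sreal1 : sreal 1 = 1.
Proof. by apply: scalar_eq; rewrite ?sRe_real ?sIm_real; case: k. Qed.

Lemma srealD a a' : sreal (a + a') = sreal a + sreal a'.
Proof. by apply: scalar_eq; rewrite ?sReD ?sImD !(sRe_real, sIm_real) ?addr0. Qed.

Lemma srealM a a' : sreal (a * a') = sreal a * sreal a'.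
Proof.
apply: scalar_eq; rewrite ?sReM ?sImM !(sRe_real, sIm_real) ?mul0r ?mulr0 ?subr0//.
by rewrite addr0.
Qed.

Section vectors.
Context (n : nat).
Implicit Types (u v x : 'cV[K]_n).

(** The real part of the hermitian product, which makes [K^n] a real Euclidean space. *)
Definition rdot v x : R :=
  \sum_(i < n) (sRe (v i 0) * sRe (x i 0) + sIm (v i 0) * sIm (x i 0)).

Lemma rdotC v x : rdot v x = rdot x v.
Proof. by apply: eq_bigr => i _; ring. Qed.

Lemma rdotDl u v x : rdot (u + v) x = rdot u x + rdot v x.
Proof.
by rewrite -big_split; apply: eq_bigr => i _ /=; rewrite !mxE sReD sImD; ring.
Qed.

Lemma rdotZl a v x : rdot (sreal a *: v) x = a * rdot v x.
Proof.
rewrite mulr_sumr; apply: eq_bigr => i _.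
by rewrite !mxE sReM sImM sRe_real sIm_real; ring.
Qed.

Lemma rdot_ge0 v : 0 <= rdot v v.
Proof. by apply: sumr_ge0 => i _; rewrite addr_ge0// -expr2 sqr_ge0. Qed.

Lemma enormE v : enorm v = Num.sqrt (rdot v v).
Proof.
by congr Num.sqrt; apply: eq_bigr => i _; rewrite sabsE !expr2.
Qed.

Lemma sqr_enorm v : enorm v ^+ 2 = rdot v v.
Proof. by rewrite enormE sqr_sqrtr ?rdot_ge0. Qed.

Lemma enorm_ge0 v : 0 <= enorm v. Proof. exact: sqrtr_ge0. Qed.

Lemma rdot_le v x : `|rdot v x| <= rdot v v + rdot x x.
Proof.
have h1 : rdot (v + x) (v + x) = rdot v v + 2 * rdot v x + rdot x x.
  by rewrite !(rdotDl, rdotC _ (v + x)) (rdotC x v); ring.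
have h2 : rdot (v - x) (v - x) = rdot v v - 2 * rdot v x + rdot x x.
  have -> : - x = sreal (- 1) *: x.
    have -> : sreal (- 1) = - 1.
      by apply: (addrI 1); rewrite -{1}sreal1 -srealD subrr subrr /sreal; case: k.
    by rewrite scaleN1r.
  rewrite !(rdotDl, rdotC _ (v + _)) !(rdotC _ (_ *: x)) !rdotZl.
  by rewrite !(rdotC _ (_ *: x)) !rdotZl (rdotC x v); ring.
have := rdot_ge0 (v + x); have := rdot_ge0 (v - x); rewrite h1 h2 ler_norml.
by have := rdot_ge0 v; have := rdot_ge0 x; lra.
Qed.

End vectors.
End scalars.

(** * Square-integrable functions as a real semi-inner product space *)

Section square_integrable.
Context (R : realType) (k : field_kind) (d : measure_display)
  (X : measurableType d) (m : {measure set X -> \bar R}) (n : nat).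
Local Notation K := (sfield R k).
Local Notation vfun := (X -> 'cV[K]_n).
Local Notation L2 := (@Lp R k d X m n 2%:E).
Implicit Types (f g : vfun).

Lemma measurable_rdot f g : vec_measurable f -> vec_measurable g ->
  measurable_fun setT (fun x => rdot (f x) (g x)).
Proof.
move=> mf mg; apply: measurable_sum => i.
have [fr fi] := mf i; have [gr gi] := mg i.
by apply: measurable_funD; exact: measurable_funM.
Qed.

Lemma vnorm2E f :
  vnorm m 2%:E f = ((\int[m]_x (rdot (f x) (f x))%:E) `^ 2^-1)%E.
Proof.
rewrite /vnorm unlock /Lnorm; congr poweR; apply: eq_integral => x _.
by rewrite /= ger0_norm ?enorm_ge0// powR_mulrn ?enorm_ge0// sqr_enorm.
Qed.

Lemma Lp2P f : L2 f <->
  vec_measurable f /\ (\int[m]_x (rdot (f x) (f x))%:E < +oo)%E.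
Proof.
rewrite /Lp/= vnorm2E; split => -[mf]; set I := (\int[m]_x _)%E.
  have : (0 <= I)%E by apply: integral_ge0 => x _; rewrite lee_fin rdot_ge0.
  case: I => [r _ _|_|//]; first by rewrite ltry.
  by rewrite poweRyr.
have : (0 <= I)%E by apply: integral_ge0 => x _; rewrite lee_fin rdot_ge0.
by case: I => [r|//|//] _ _; split => //=; rewrite ltry.
Qed.

Lemma integrable_rdot f g : L2 f -> L2 g ->
  m.-integrable setT (EFin \o (fun x => rdot (f x) (g x))).
Proof.
move=> /Lp2P[mf intf] /Lp2P[mg intg].
have diag (h : vfun) : vec_measurable h -> (\int[m]_x (rdot (h x) (h x))%:E < +oo)%E ->
    m.-integrable setT (EFin \o (fun x => rdot (h x) (h x))).
  move=> mh inth; apply/integrableP; split.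
    by apply/measurable_EFinP; exact: measurable_rdot.
  by under eq_integral do rewrite /= ger0_norm ?rdot_ge0//.
apply: (le_integrable _ _ _ (integrableD _ (diag f mf intf) (diag g mg intg))) => //.
  by apply/measurable_EFinP; exact: measurable_rdot.
move=> x _ /=; rewrite lee_fin [leRHS]ger0_norm; first exact: rdot_le.
by rewrite addr_ge0// rdot_ge0.
Qed.

Definition rip f g : R := \int[m]_x rdot (f x) (g x).

Lemma rip_inner f g : sRe (inner m f g) = rip f g.
Proof.
rewrite /inner; set h := fun x => _.
have -> a b : sRe (smk k a b : K) = a by case: k.
apply: eq_Rintegral => x _; rewrite /h sRe_sum; apply: eq_bigr => i _.
by rewrite sReM sRe_conj sIm_conj; ring.
Qed.

Lemma vnorm2_rip f : L2 f -> vnorm m 2%:E f = (Num.sqrt (rip f f))%:E.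
Proof.
move=> L2f; have fin : ((\int[m]_x (rdot (f x) (f x))%:E)%E \is a fin_num).
  by have := integrable_fin_num measurableT (integrable_rdot L2f L2f).
rewrite vnorm2E /rip /Rintegral -{1}(fineK fin) poweR_EFin powR12_sqrt//.
by rewrite fine_ge0// integral_ge0// => x _; rewrite lee_fin rdot_ge0.
Qed.

Lemma ripC f g : rip f g = rip g f.
Proof. by apply: eq_Rintegral => x _; rewrite rdotC. Qed.

Lemma aeeq_rip f f' g : L2 f -> L2 f' -> L2 g -> aeeq m f f' -> rip f g = rip f' g.
Proof.
move=> L2f L2f' L2g ff'; congr fine; apply: ae_eq_integral => //.
- exact: measurable_int (integrable_rdot L2f L2g).
- exact: measurable_int (integrable_rdot L2f' L2g).
- by apply: filterS ff' => x xff' _ /=; rewrite xff'.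
Qed.

Lemma vec_measurable_lin (a : K) f g : vec_measurable f -> vec_measurable g ->
  vec_measurable (fun x => a *: f x + g x).
Proof.
move=> mf mg i; have [fr fi] := mf i; have [gr gi] := mg i; split.
  under eq_fun do rewrite !mxE sReD sReM.
  apply: measurable_funD => //; apply: measurable_funB;
    by apply: measurable_funM => //; exact: measurable_cst.
under eq_fun do rewrite !mxE sImD sImM.
apply: measurable_funD => //; apply: measurable_funD;
  by apply: measurable_funM => //; exact: measurable_cst.
Qed.

Lemma rdot_lin_le (a : K) (v w : 'cV[K]_n) :
  rdot (a *: v + w) (a *: v + w) <=
  (2 * sabs a ^+ 2) * rdot v v + 2 * rdot w w.
Proof.
rewrite !mulr_sumr -big_split; apply: ler_sum => i _ /=.
rewrite !mxE sReD sImD sReM sImM sabsE.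
set p := sRe a; set q := sIm a; set x := sRe (v i 0); set y := sIm (v i 0).
set z := sRe (w i 0); set t := sIm (w i 0).
have := sqr_ge0 (p * x - q * y - z); have := sqr_ge0 (p * y + q * x - t).
by lra.
Qed.

Lemma L2_lin (a : K) f g : L2 f -> L2 g -> L2 (fun x => a *: f x + g x).
Proof.
move=> L2f L2g; have [mf _] := L2f; have [mg _] := L2g.
apply/Lp2P; split; first exact: vec_measurable_lin.
have int2 : m.-integrable setT (EFin \o (fun x => (2 * sabs a ^+ 2) * rdot (f x) (f x) +
    2 * rdot (g x) (g x))).
  have h1 := integrableZl measurableT (2 * sabs a ^+ 2) (integrable_rdot L2f L2f).
  have h2 := integrableZl measurableT 2 (integrable_rdot L2g L2g).
  by have := integrableD measurableT h1 h2; apply: eq_integrable.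
have /integrableP[_] := int2; apply: le_lt_trans.
apply: ge0_le_integral => //.
- by move=> x _; rewrite lee_fin rdot_ge0.
- apply/measurable_EFinP; apply: measurable_rdot; exact: vec_measurable_lin.
- by apply: measurableT_comp => //; exact: measurable_int int2.
- by move=> x _; rewrite lee_fin (le_trans (rdot_lin_le _ _ _))// ler_norm.
Qed.

Lemma L2_0 : L2 (fun=> 0).
Proof.
apply/Lp2P; split.
  move=> i; split; under eq_fun do rewrite mxE ?sRe0 ?sIm0; exact: measurable_cst.
rewrite (eq_integral (cst 0%E)) ?integral0// => x _.
by rewrite /rdot big1// => i _; rewrite mxE sRe0 sIm0 !mulr0 addr0.
Qed.

End square_integrable.

Section L2_space.
Context (R : realType) (k : field_kind) (d : measure_display)
  (X : measurableType d) (m : {measure set X -> \bar R}) (n : nat).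
Local Notation K := (sfield R k).
Local Notation vfun := (X -> 'cV[K]_n).
Local Notation L2 := (@Lp R k d X m n 2%:E).

Record l2 := MkL2 { l2fun :> vfun ; l2P : L2 l2fun }.

Lemma l2_eq (x y : l2) : (forall t, l2fun x t = l2fun y t) -> x = y.
Proof.
case: x y => [f L2f] [g L2g] /= fg.
have {}fg : f = g by exact/funext.
by rewrite -fg in L2g *; congr MkL2; exact: Prop_irrelevance.
Qed.

HB.instance Definition _ := gen_eqMixin l2.
HB.instance Definition _ := gen_choiceMixin l2.

Definition l2_lin (a : K) (x y : l2) := MkL2 (L2_lin a (l2P x) (l2P y)).
Definition l2_zero := MkL2 (@L2_0 R k d X m n).
Definition l2_add x y := l2_lin 1 x y.
Definition l2_opp x := l2_lin (-1) x l2_zero.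
Definition l2_scale (a : R) x := l2_lin (sreal k a) x l2_zero.

Fact l2_addA : associative l2_add.
Proof. by move=> x y z; apply: l2_eq => t /=; rewrite !scale1r addrA. Qed.
Fact l2_addC : commutative l2_add.
Proof. by move=> x y; apply: l2_eq => t /=; rewrite !scale1r addrC. Qed.
Fact l2_add0 : left_id l2_zero l2_add.
Proof. by move=> x; apply: l2_eq => t /=; rewrite scale1r add0r. Qed.
Fact l2_addN : left_inverse l2_zero l2_opp l2_add.
Proof.
by move=> x; apply: l2_eq => t /=; rewrite scale1r addr0 scaleN1r addNr.
Qed.
HB.instance Definition _ :=
  GRing.isZmodule.Build l2 l2_addA l2_addC l2_add0 l2_addN.

Lemma l2_addE (x y : l2) t : (x + y : l2) t = x t + y t.
Proof. by rewrite -[LHS]/(1 *: x t + y t) scale1r. Qed.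
Lemma l2_oppE (x : l2) t : (- x : l2) t = - x t.
Proof. by rewrite -[LHS]/(-1 *: x t + 0) scaleN1r addr0. Qed.

Fact l2_scaleA a c x : l2_scale a (l2_scale c x) = l2_scale (a * c) x.
Proof. by apply: l2_eq => t /=; rewrite !addr0 scalerA srealM. Qed.
Fact l2_scale1 : left_id 1 l2_scale.
Proof. by move=> x; apply: l2_eq => t /=; rewrite sreal1 scale1r addr0. Qed.
Fact l2_scaleDr : right_distributive l2_scale +%R.
Proof.
by move=> a x y; apply: l2_eq => t; rewrite /= !scale1r !addr0 scalerDr.
Qed.
Fact l2_scaleDl x : {morph l2_scale^~ x : a c / a + c}.
Proof.
by move=> a c; apply: l2_eq => t; rewrite /= !scale1r !addr0 srealD scalerDl.
Qed.
HB.instance Definition _ := GRing.Zmodule_isLmodule.Build R l2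
  l2_scaleA l2_scale1 l2_scaleDr l2_scaleDl.

Lemma l2_scaleE (a : R) (x : l2) t : (a *: x : l2) t = sreal k a *: x t.
Proof. by rewrite -[LHS]/(sreal k a *: x t + 0) addr0. Qed.

Lemma l2_realE (a : R) (x y : l2) t :
  (a *: x + y : l2) t = sreal k a *: x t + y t.
Proof. by rewrite l2_addE l2_scaleE. Qed.

Let ripC' (x y : l2) : rip m x y = rip m y x. Proof. exact: ripC. Qed.
Let ripDl' (x y z : l2) : rip m (x + y : l2) z = rip m x z + rip m y z.
Proof.
rewrite -RintegralD//; [|exact: integrable_rdot (l2P _) (l2P _)..].
by apply: eq_Rintegral => t _; rewrite l2_addE rdotDl.
Qed.
Let ripZl' (a : R) (x y : l2) : rip m (a *: x : l2) y = a * rip m x y.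
Proof.
rewrite -RintegralZl//; last exact: integrable_rdot (l2P _) (l2P _).
by apply: eq_Rintegral => t _; rewrite l2_scaleE rdotZl.
Qed.
Let rip_ge0' (x : l2) : 0 <= rip m x x.
Proof. by apply: Rintegral_ge0 => t _; exact: rdot_ge0. Qed.

Definition l2_inner : semi_inner l2 := SemiInner ripC' ripDl' ripZl' rip_ge0'.

Lemma l2_innerE (x y : l2) : l2_inner x y = sRe (inner m x y).
Proof. by rewrite rip_inner. Qed.

Lemma vnorm_l2 (x : l2) : vnorm m 2%:E x = (nm l2_inner x)%:E.
Proof. exact: vnorm2_rip (l2P x). Qed.

Lemma l2_weak_eq (x y z : l2) : aeeq m x y -> l2_inner x z = l2_inner y z.
Proof. exact: aeeq_rip (l2P x) (l2P y) (l2P z). Qed.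

(** The action of a partial operator is arbitrary outside its domain and may leave [Lp 2]; 0 is a
    default for that case, which [liftE] excludes. *)
Definition lift (T : vfun -> vfun) (x : l2) : l2 :=
  if pselect (L2 (T x)) is left h then MkL2 h else 0.

Lemma liftE (T : vfun -> vfun) (x : l2) : L2 (T x) -> l2fun (lift T x) = T x.
Proof. by rewrite /lift; case: pselect. Qed.

Definition lift_dom (A : partial_op R k X n) : set l2 := [set x | dom A x].

Lemma lift_sym (A : partial_op R k X n) (x y : l2) : linear_op m A ->
  symmetric_op m A -> dom A x -> dom A y ->
  l2_inner (lift (act A) x) y = l2_inner x (lift (act A) y).
Proof.
move=> [_ _ AL2 _ _] Asym Dx Dy; have := Asym x y Dx Dy.
by rewrite !l2_innerE !liftE; [move=> ->|exact: AL2..].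
Qed.

Section spectral.
Context (E : spectral_measure k m n).

(** The axioms of [spectral_measure] concern measurable sets; for other [B] the identity is a
    placeholder. *)
Let P B := if pselect (measurable B) is left _ then lift (sproj E B) else id.

Let P_E B (x : l2) : measurable B -> l2fun (P B x) = sproj E B x.
Proof.
move=> mB; rewrite /P; case: pselect => // _; apply: liftE.
by have [_ _ h _ _] := sproj_linear E mB; apply: h; exact: l2P.
Qed.

Let P_sym B (x y : l2) : measurable B ->
  l2_inner (P B x) y = l2_inner x (P B y).
Proof.
move=> mB; have := sproj_symmetric (s := E) mB (l2P x) (l2P y).
by rewrite !l2_innerE !P_E//= => ->.
Qed.

Let P_T (x y : l2) : l2_inner (P setT x) y = l2_inner x y.
Proof. by apply: l2_weak_eq; rewrite P_E//; exact: sprojT (l2P x). Qed.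

Let P_I B C (x y : l2) : measurable B -> measurable C ->
  l2_inner (P (B `&` C) x) y = l2_inner (P B (P C x)) y.
Proof.
move=> mB mC; apply: l2_weak_eq.
rewrite !P_E//; last exact: measurableI.
exact: sprojI mB mC (l2P x).
Qed.

Let P_meas B (x : l2) : measurable B ->
  smeas E x B = (l2_inner (P B x) x)%:E.
Proof. by move=> mB; rewrite l2_innerE P_E//; exact: smeasE mB (l2P x). Qed.

Definition lift_spectral : spectral_family l2_inner :=
  @SpectralFamily R l2 l2_inner P (fun x => smeas E x) P_sym P_T P_I P_meas.

Lemma lift_integral phi (A : partial_op R k X n) : spectral_integral E phi A ->
  op_integral lift_spectral phi (lift_dom A) (lift (act A)).
Proof.
move=> [lA sA domA formA]; have [DL2 D0 AL2 Aae Alin] := lA; split.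
- move=> x; rewrite -[lift_dom A x]/(dom A x); split=> [/domA[]//|int_fin].
  by apply/domA; split => //; exact: l2P.
- move=> a x y Dx Dy; have [D _] := Alin (sreal k a) x y Dx Dy.
  have E1 : l2fun (a *: x + y) = (fun t => sreal k a *: x t + y t).
    by apply/funext => t; rewrite l2_realE.
  by rewrite -[lift_dom _ _]/(dom A (l2fun (a *: x + y))) E1.
- move=> a x y z Dx Dy; have [D ae] := Alin (sreal k a) x y Dx Dy.
  have E1 : l2fun (a *: x + y) = (fun t => sreal k a *: x t + y t).
    by apply/funext => t; rewrite l2_realE.
  rewrite -ipZl -ipDl; apply: l2_weak_eq.
  rewrite liftE E1; last exact: AL2.
  apply: filterS ae => t; rewrite l2_realE !liftE//; exact: AL2.
- by move=> x y Dx Dy; exact: lift_sym.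
- by move=> x Dx; rewrite l2_innerE liftE; [exact: formA|exact: AL2].
Qed.

End spectral.
End L2_space.

(** * The multiplication operator *)

Section multiplication.
Context (R : realType) (k : field_kind).
Local Notation K := (sfield R k).

Lemma sabs_ge0 (z : K) : 0 <= sabs z.
Proof. by rewrite /sabs; case: k z => [z|[a b]] /=; rewrite ?normr_ge0 ?sqrtr_ge0. Qed.

Lemma sabsM (z w : K) : sabs (z * w) = sabs z * sabs w.
Proof.
apply/eqP; rewrite -(@eqrXn2 _ 2) ?mulr_ge0 ?sabs_ge0// exprMn !sabsE sReM sImM.
by apply/eqP; ring.
Qed.

Lemma sabsD (z w : K) : sabs (z + w) <= sabs z + sabs w.
Proof.
rewrite -(@ler_pXn2r _ 2) ?nnegrE ?addr_ge0 ?sabs_ge0// sabsE sReD sImD.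
have zw : sRe z * sRe w + sIm z * sIm w <= sabs z * sabs w.
  apply: (le_trans (ler_norm _)).
  rewrite -(@ler_pXn2r _ 2) ?nnegrE ?mulr_ge0 ?sabs_ge0// real_normK ?num_real//.
  rewrite exprMn !sabsE; have := sqr_ge0 (sRe z * sIm w - sIm z * sRe w); lra.
rewrite [leRHS]sqrrD !sabsE; lra.
Qed.

Lemma sabs_sum_le I (r : seq I) (P : pred I) (z w : I -> K) :
  sabs (\sum_(i <- r | P i) z i * w i) ^+ 2 <=
  (\sum_(i <- r | P i) sabs (z i) ^+ 2) * (\sum_(i <- r | P i) sabs (w i) ^+ 2).
Proof.
apply: le_trans (sum_cauchy_schwarz _ _ _ _).
rewrite lerXn2r ?nnegrE ?sabs_ge0//.
  by apply: sumr_ge0 => i _; rewrite mulr_ge0 ?sabs_ge0.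
elim/big_rec2 : _ => [|i x y _ yx]; last first.
  by apply: (le_trans (sabsD _ _)); rewrite sabsM lerD2l.
by rewrite /sabs normr0 sRe0.
Qed.

Context (n : nat).
Implicit Types (A : 'M[K]_n) (v w : 'cV[K]_n).

Lemma rdot_sabs v : rdot v v = \sum_(i < n) sabs (v i 0) ^+ 2.
Proof. by apply: eq_bigr => i _; rewrite sabsE !expr2. Qed.

Lemma sqr_frobenius A : frobenius A ^+ 2 = \sum_(i < n) \sum_(j < n) sabs (A i j) ^+ 2.
Proof.
rewrite sqr_sqrtr//; apply: sumr_ge0 => i _; apply: sumr_ge0 => j _.
exact: sqr_ge0.
Qed.

(** Cauchy-Schwarz in each row. The Frobenius norm thus controls the pointwise action of [V], both
    for the boundedness of [mul_op V] and for the Hilbert-Schmidt estimate. *)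
Lemma rdot_mulmx_le A v :
  rdot (A *m v) (A *m v) <= frobenius A ^+ 2 * rdot v v.
Proof.
rewrite sqr_frobenius mulr_suml !rdot_sabs; apply: ler_sum => i _.
by rewrite mxE; exact: sabs_sum_le.
Qed.

Lemma rdot_hermitian A v w : is_hermitian A -> rdot (A *m v) w = rdot v (A *m w).
Proof.
move=> hA; have AE i j : A i j = sconj (A j i) by rewrite -{1}hA !mxE.
transitivity (\sum_(i < n) \sum_(j < n)
   (sRe (A i j * v j 0) * sRe (w i 0) + sIm (A i j * v j 0) * sIm (w i 0))).
  apply: eq_bigr => i _; rewrite !mxE sRe_sum sIm_sum !mulr_suml -big_split.
  by apply: eq_bigr.
rewrite exchange_big/=; apply: eq_bigr => j _.
rewrite !mxE sRe_sum sIm_sum !mulr_sumr -big_split; apply: eq_bigr => i _ /=.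
by rewrite (AE i j) !sReM !sImM !sRe_conj !sIm_conj; ring.
Qed.

Context (d : measure_display) (X : measurableType d)
  (m : {measure set X -> \bar R}).
Context (V : X -> 'M[K]_n).
Hypotheses (V_measurable : mat_measurable V)
  (V_hermitian : forall x, is_hermitian (V x))
  (V_Loo : (mnorm m +oo V < +oo)%E).
Local Notation L2 := (@Lp R k d X m n 2%:E).

Lemma vec_measurable_mul_op (f : X -> 'cV[K]_n) :
  vec_measurable f -> vec_measurable (mul_op V f).
Proof.
move=> mf i; split.
  under eq_fun do rewrite mxE sRe_sum; apply: measurable_sum => j.
  have [Vr Vi] := V_measurable i j; have [fr fi] := mf j.
  by under eq_fun do rewrite sReM; apply: measurable_funB; exact: measurable_funM.
under eq_fun do rewrite mxE sIm_sum; apply: measurable_sum => j.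
have [Vr Vi] := V_measurable i j; have [fr fi] := mf j.
by under eq_fun do rewrite sImM; apply: measurable_funD; exact: measurable_funM.
Qed.

Lemma Lnorm_infty_ae (g : X -> R) : (forall x, 0 <= g x) ->
  (Lnorm m +oo (fun x => (g x)%:E) < +oo)%E ->
  {ae m, forall x, g x <= fine (Lnorm m +oo (fun x => (g x)%:E))}.
Proof.
move=> g0; rewrite unlock /Lnorm; case: ifPn => [m0 supy|].
  set s := ess_sup _ _ in supy *.
  have s0 : (0 <= s)%E by apply: ess_sup_gee => //; apply: nearW => x; exact: abse_ge0.
  have := ess_sup_ge m (abse \o (fun x => (g x)%:E)); rewrite -/s.
  apply: filterS => x /=; rewrite ger0_norm// -lee_fin fineK// ge0_fin_numE//.
(* If the whole space has measure zero, the norm is zero by convention and the whole space serves as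
   exceptional set. *)
rewrite -leNgt => m0 _; exists setT; split => //.
by apply/eqP; rewrite eq_le m0 measure_ge0.
Qed.

Let c := fine (mnorm m +oo V).

Lemma frobenius_ge0 (A : 'M[K]_n) : 0 <= frobenius A.
Proof. exact: sqrtr_ge0. Qed.

Lemma mnorm_infty_ae : {ae m, forall x, frobenius (V x) <= c}.
Proof. by apply: Lnorm_infty_ae => // x; exact: frobenius_ge0. Qed.

Lemma mnorm_infty_ge0 : 0 <= c.
Proof. by rewrite fine_ge0// Lnorm_ge0. Qed.

Lemma mul_op_bound (f : X -> 'cV[K]_n) : L2 f -> L2 (mul_op V f) /\
  rip m (mul_op V f) (mul_op V f) <= c ^+ 2 * rip m f f.
Proof.
move=> L2f; have [mf _] := L2f.
have mVf := vec_measurable_mul_op mf.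
have iff := integrable_rdot L2f L2f.
have icf := integrableZl measurableT (c ^+ 2) iff.
have le_int : (\int[m]_x (rdot (mul_op V f x) (mul_op V f x))%:E <=
    \int[m]_x (c ^+ 2 * rdot (f x) (f x))%:E)%E.
  apply: ae_ge0_le_integral => //.
  - by move=> x _; rewrite lee_fin rdot_ge0.
  - by apply/measurable_EFinP; exact: measurable_rdot.
  - by move=> x _; rewrite lee_fin mulr_ge0 ?sqr_ge0 ?rdot_ge0.
  - exact: measurable_int icf.
  apply: filterS mnorm_infty_ae => x Vc _; rewrite lee_fin.
  apply: (le_trans (rdot_mulmx_le _ _)); rewrite ler_wpM2r ?rdot_ge0//.
  by rewrite lerXn2r ?nnegrE ?frobenius_ge0 ?mnorm_infty_ge0.
have fin := integrable_fin_num measurableT icf.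
have L2Vf : L2 (mul_op V f).
  apply/Lp2P; split => //; apply: (le_lt_trans le_int).
  by move: fin; rewrite fin_numE => /andP[_]; rewrite ltey.
split => //; rewrite -lee_fin.
have iVf := integrable_fin_num measurableT (integrable_rdot L2Vf L2Vf).
rewrite /rip /Rintegral fineK//; apply: (le_trans le_int).
have fin2 := integrable_fin_num measurableT iff.
by rewrite EFinM (fineK fin2) -(integralZl measurableT iff).
Qed.

Local Notation W := (@lift R k d X m n (mul_op V)).

Lemma lift_mul_opE (x : l2 k m n) : l2fun (W x) = mul_op V x.
Proof. by apply: liftE; have [] := mul_op_bound (l2P x). Qed.

Lemma lift_mul_op_sym (x y : l2 k m n) :
  l2_inner k m n (W x) y = l2_inner k m n x (W y).
Proof.
rewrite /l2_inner/= !lift_mul_opE; apply: eq_Rintegral => t _.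
exact: rdot_hermitian.
Qed.

Lemma lift_mul_op_le (x : l2 k m n) : nm (l2_inner k m n) (W x) <= c * nm (l2_inner k m n) x.
Proof.
apply: nm_le; first by rewrite mulr_ge0 ?nm_ge0 ?mnorm_infty_ge0.
rewrite exprMn sqr_nm /l2_inner/= lift_mul_opE.
by have [] := mul_op_bound (l2P x).
Qed.

End multiplication.

(** * Pointwise and Hilbert-Schmidt bounds for smoothing operators *)

Definition real_dim (k : field_kind) : nat :=
  match k with RealScalars => 1 | ComplexScalars => 2 end.

Lemma sIm_eq0 (R : realType) (k : field_kind) (z : sfield R k) :
  real_dim k = 1%N -> sIm z = 0.
Proof. by case: k z. Qed.

(* A rational vector between 0 and M stands in for M itself, so that countably
   many test vectors suffice. *)
Lemma rational_dual_bound (R : realType) N (M : nat -> R) (B : R) : 0 <= B ->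
  (forall s : seq rat, (\sum_(j < N) ratr s`_j * M j) ^+ 2 <=
    B * \sum_(j < N) ratr s`_j ^+ 2) ->
  \sum_(j < N) M j ^+ 2 <= B.
Proof.
move=> B0 hB; apply/ler_addgt0Pr => eps eps0.
have N0 : 0 < (N%:R + 1 : R) by rewrite ltr_wpDl.
have approx_gt0 (x eta : R) : 0 < eta -> 0 < x ->
    exists q : rat, ratr q ^+ 2 <= ratr q * x /\ x ^+ 2 - eta <= ratr q * x.
  (* Every rational in this interval works: after multiplication by a positive number, [q <= x]
     gives the first inequality and [q >= x - eta / x] the second. *)
  move=> eta0 x0; have [|q] := @rat_in_itvoo R (Num.max (x - eta / x) 0) x.
    by rewrite gt_max x0 andbT ltrBlDr ltrDl divr_gt0.
  rewrite in_itv/= gt_max => /andP[/andP[q1 q0] qx]; exists q; split.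
    by rewrite expr2 ler_wpM2l// ltW.
  have -> : x ^+ 2 - eta = (x - eta / x) * x by field; rewrite gt_eqF.
  by rewrite ler_wpM2r ?ltW.
have approx (x eta : R) : 0 < eta ->
    exists q : rat, ratr q ^+ 2 <= ratr q * x /\ x ^+ 2 - eta <= ratr q * x.
  move=> eta0; have [x0|x0|->] := ltgtP x 0; last 2 first.
  - exact: approx_gt0.
  - by exists 0; rewrite rmorph0 mulr0 expr0n/= sub0r oppr_le0; split => //; exact: ltW.
  have [|q [q1 q2]] := approx_gt0 (- x) eta eta0; first by rewrite oppr_gt0.
  by exists (- q); rewrite rmorphN/= sqrrN mulNr -mulrN -(sqrrN x).
(* An error of [eps / (N + 1)] in each of the [N] coordinates adds up to at most [eps]. *)
have eta0 : 0 < eps / (N%:R + 1) by rewrite divr_gt0.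
have [q hq] := choice (fun j => approx (M j) _ eta0).
have hP := hB (mkseq q N); set P := \sum_(j < N) ratr (q j) * M j.
have e1 : \sum_(j < N) ratr (mkseq q N)`_j * M j = P.
  by apply: eq_bigr => j _; rewrite nth_mkseq.
have e2 : \sum_(j < N) ratr (mkseq q N)`_j ^+ 2 = \sum_(j < N) (ratr (q j) : R) ^+ 2.
  by apply: eq_bigr => j _; rewrite nth_mkseq.
rewrite e1 e2 in hP.
have sP : \sum_(j < N) (ratr (q j) : R) ^+ 2 <= P.
  by apply: ler_sum => j _; have [] := hq j.
have P0 : 0 <= P by apply: le_trans sP; apply: sumr_ge0 => j _; exact: sqr_ge0.
(* The hypothesis and [sP] give [P ^ 2 <= B * P], from which a nonzero [P] cancels. *)
have PB : P <= B.
  have := le_trans hP (ler_wpM2l B0 sP); rewrite expr2.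
  by have [->//|Pn0] := eqVneq P 0; rewrite ler_pM2r// lt_neqAle eq_sym Pn0.
apply: (@le_trans _ _ (P + eps)); last by rewrite lerD2r.
rewrite -lerBlDr; apply: (@le_trans _ _ (\sum_(j < N) (M j ^+ 2 - eps / (N%:R + 1)))).
  rewrite sumrB lerD2l lerN2 sumr_const card_ord -(mulr_natr (eps / _)) mulrAC.
  by rewrite ler_pdivrMr// ler_wpM2l ?ltW// ltrDl.
by apply: ler_sum => j _; have [] := hq j.
Qed.

Section smoothing.
Context (R : realType) (k : field_kind) (d : measure_display)
  (X : measurableType d) (m : {measure set X -> \bar R}) (n : nat).
Local Notation K := (sfield R k).
Local Notation vfun := (X -> 'cV[K]_n).
Local Notation L2 := (@Lp R k d X m n 2%:E).
Context (T : vfun -> vfun).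
Hypotheses (T_linear : linear_op m (total_op m T))
  (T_bounded : (opnorm m 2%:E +oo T < +oo)%E).
Let C := fine (opnorm m 2%:E +oo T).

Let TL2 f : L2 f -> L2 (T f).
Proof. by have [_ _ h _ _] := T_linear; exact: h. Qed.

Let T_lin (a : K) f g : L2 f -> L2 g ->
  aeeq m (T (fun x => a *: f x + g x)) (fun x => a *: T f x + T g x).
Proof. by move=> Lf Lg; have [_ _ _ _ h] := T_linear; have [] := h a f g Lf Lg. Qed.

Let T0 : aeeq m (T (fun=> 0)) (fun=> 0).
Proof.
have := T_lin (-1) (@L2_0 R k d X m n) (@L2_0 R k d X m n).
rewrite (_ : (fun x => _) = (fun=> 0)); last by apply/funext => x; rewrite scaler0 addr0.
by apply: filterS => x ->; rewrite scaleN1r addNr.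
Qed.

Local Notation l2 := (l2 k m n).
Local Notation b := (l2_inner k m n).

Lemma opnorm_ge (q : \bar R) (S : vfun -> vfun) (x : l2) : nm b x <= 1 ->
  (vnorm m q (S x) <= opnorm m 2%:E q S)%E.
Proof.
move=> x1; apply: ereal_sup_ubound; exists (l2fun x) => //; split; first exact: l2P.
by rewrite vnorm_l2 lee_fin.
Qed.

Lemma opnorm_ge0 (q : \bar R) (S : vfun -> vfun) : (0 <= opnorm m 2%:E q S)%E.
Proof.
apply: le_trans (opnorm_ge q S (x := 0) _); first exact: Lnorm_ge0.
by rewrite nm0.
Qed.

Lemma enorm_sreal (a : R) (v : 'cV[K]_n) : 0 <= a ->
  enorm (sreal k a *: v) = a * enorm v.
Proof.
move=> a0; rewrite !enormE rdotZl rdotC rdotZl mulrA sqrtrM ?mulr_ge0//.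
by rewrite -expr2 sqrtr_sqr ger0_norm.
Qed.

(** Rescaling to the unit ball. Here [rho] is a positive bound rather than the length of [x], which
    may be zero and then cannot be divided by. *)
Lemma smoothing_ae (x : l2) rho : 0 < rho -> nm b x <= rho ->
  {ae m, forall t, enorm (T x t) <= C * rho}.
Proof.
move=> rho0 xrho; pose y : l2 := rho^-1 *: x.
have y1 : nm b y <= 1.
  by rewrite /y nmZ ger0_norm ?invr_ge0 ?(ltW rho0)// ler_pdivrMl// mulr1.
have yC := opnorm_ge +oo T y1.
have bnd : {ae m, forall t, enorm (T y t) <= C}.
  apply: filterS (Lnorm_infty_ae (m := m) (fun t => enorm_ge0 (T y t))
    (le_lt_trans yC T_bounded)) => t /le_trans; apply.
  by apply: fine_le => //; rewrite ge0_fin_numE ?Lnorm_ge0 ?opnorm_ge0//;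
    exact: le_lt_trans yC T_bounded.
(* [rho *: y] is written as [(rho - 1) *: y + y], the shape in which linearity of [T] is given. *)
have xE : l2fun x = (fun t => sreal k (rho - 1) *: y t + y t).
  apply/funext => t; rewrite -l2_realE; congr (l2fun _ t).
  by rewrite -{2}(scale1r y) -scalerDl subrK scalerA divff ?scale1r// gt_eqF.
have := T_lin (sreal k (rho - 1)) (l2P y) (l2P y); rewrite -xE.
apply: filterS2 bnd => t yt ->.
rewrite -{2}(scale1r (T y t)) -scalerDl -sreal1 -srealD subrK.
by rewrite enorm_sreal ?(ltW rho0)// mulrC ler_wpM2r// (ltW rho0).
Qed.

Lemma smoothing_comb N (a : nat -> R) (F : nat -> l2) :
  {ae m, forall t, T (\sum_(j < N) a j *: F j : l2) t =
                   \sum_(j < N) sreal k (a j) *: T (F j) t}.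
Proof.
elim: N => [|N ih].
  rewrite big_ord0; apply: filterS T0 => t T0t; rewrite big_ord0 -[RHS]T0t.
  by congr T.
have E1 : l2fun (\sum_(j < N.+1) a j *: F j) =
    (fun t => sreal k (a N) *: F N t + (\sum_(j < N) a j *: F j : l2) t).
  by apply/funext => t; rewrite big_ord_recr l2_addE l2_scaleE addrC.
rewrite E1; have := T_lin (sreal k (a N)) (l2P (F N)) (l2P (\sum_(j < N) a j *: F j)).
by apply: filterS2 ih => t iht ->; rewrite iht big_ord_recr/= addrC.
Qed.

Let C0 : 0 <= C.
Proof. by rewrite fine_ge0// opnorm_ge0. Qed.

(** Each coefficient vector has its own exceptional null set. Rational vectors are enumerated by
    [pickle], so one null set serves them all. *)
Lemma smoothing_rational r N (F : nat -> l2) : 0 < r -> bessel b r N F ->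
  {ae m, forall t, forall s : seq rat,
    rdot (\sum_(j < N) sreal k (ratr s`_j) *: T (F j) t)
         (\sum_(j < N) sreal k (ratr s`_j) *: T (F j) t) <=
    (C * r) ^+ 2 * \sum_(j < N) ratr s`_j ^+ 2}.
Proof.
move=> r0 bF.
suff all_ae : {ae m, forall t, forall N' : nat,
    let s := odflt [::] (unpickle N') : seq rat in
    rdot (\sum_(j < N) sreal k (ratr s`_j) *: T (F j) t)
         (\sum_(j < N) sreal k (ratr s`_j) *: T (F j) t) <=
    (C * r) ^+ 2 * \sum_(j < N) ratr s`_j ^+ 2}.
  by apply: filterS all_ae => t h s; have := h (pickle s); rewrite pickleK.
apply/ae_foralln => N'; set s := odflt _ _.
set q := \sum_(j < N) (ratr s`_j : R) ^+ 2.
have q0 : 0 <= q by apply: sumr_ge0 => j _; exact: sqr_ge0.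
(* If [q = 0], all coefficients vanish; this case is separate because [smoothing_ae] asks for a
   positive bound. *)
have [q_eq0|q_neq0] := eqVneq q 0.
  apply: nearW => t /=; rewrite -/q q_eq0 mulr0.
  have s0 (j : 'I_N) : ratr s`_j = 0 :> R.
    apply/eqP; rewrite -sqrf_eq0; apply/eqP.
    by move: q_eq0 => /psumr_eq0P -> // i _; exact: sqr_ge0.
  rewrite big1 ?/rdot => [|j _]; last first.
    by rewrite s0 (_ : sreal k 0 = 0) ?scale0r// /sreal; case: k.
  by rewrite big1// => i _; rewrite !mxE sRe0 sIm0 mul0r addr0.
have q_gt0 : 0 < q by rewrite lt_neqAle eq_sym q_neq0.
have rq : 0 < r * Num.sqrt q by rewrite mulr_gt0// sqrtr_gt0.
pose x : l2 := \sum_(j < N) (ratr s`_j : R) *: F j.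
have xr : nm b x <= r * Num.sqrt q.
  apply: nm_le; first exact: ltW.
  by rewrite exprMn sqr_sqrtr//; exact: (bF (fun j => ratr s`_j)).
apply: filterS2 (smoothing_ae rq xr) (smoothing_comb N (fun j => ratr s`_j) F).
move=> t h1 h2; rewrite /= -h2 -/x -sqr_enorm -/q.
have -> : (C * r) ^+ 2 * q = (C * (r * Num.sqrt q)) ^+ 2.
  by rewrite !exprMn sqr_sqrtr// mulrA.
by rewrite lerXn2r ?nnegrE ?enorm_ge0// mulr_ge0// ltW.
Qed.

(** Each real coordinate of a combination is at most its Euclidean norm, so [rational_dual_bound]
    bounds the square sum of that coordinate by [(C * r) ^ 2]. There are [n * real_dim k] real
    coordinates. *)
Lemma smoothing_sum r N (F : nat -> l2) : 0 < r -> bessel b r N F ->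
  {ae m, forall t, \sum_(j < N) rdot (T (F j) t) (T (F j) t) <=
    (n * real_dim k)%:R * (C * r) ^+ 2}.
Proof.
move=> r0 bF; apply: filterS (smoothing_rational r0 bF) => t ht.
set B := (C * r) ^+ 2; have B0 : 0 <= B by exact: sqr_ge0.
have coord (pr : K -> R) (i : 'I_n) : (forall z w, pr (z + w) = pr z + pr w) ->
    (forall a z, pr (sreal k a * z) = a * pr z) ->
    (forall v : 'cV[K]_n, pr (v i 0) ^+ 2 <= rdot v v) ->
    \sum_(j < N) pr (T (F j) t i 0) ^+ 2 <= B.
  move=> prD prZ pr_le.
  have pr0 : pr 0 = 0 by apply: (addrI (pr 0)); rewrite -prD !addr0.
  apply: (@rational_dual_bound R N (fun j => pr (T (F j) t i 0))) => // s; apply: le_trans (ht s).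
  apply: le_trans (pr_le _); rewrite summxE (big_morph pr prD pr0).
  by under [in leRHS]eq_bigr do rewrite mxE prZ.
have sq (v : 'cV[K]_n) (i : 'I_n) : sRe (v i 0) ^+ 2 + sIm (v i 0) ^+ 2 <= rdot v v.
  rewrite /rdot (bigD1 i)//= -!expr2 lerDl; apply: sumr_ge0 => l _.
  by rewrite -!expr2 addr_ge0 ?sqr_ge0.
rewrite exchange_big/= natrM -mulrA -[n in n%:R]card_ord mulr_natl -sumr_const.
apply: ler_sum => i _; rewrite big_split/=.
have re_le : \sum_(j < N) sRe (T (F j) t i 0) ^+ 2 <= B.
  apply: (coord (@sRe R k)) => [|a z|v]; first exact: sReD.
    by rewrite sReM sRe_real sIm_real mul0r subr0.
  by apply: le_trans (sq v i); rewrite lerDl sqr_ge0.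
have sum_sq (pr : K -> R) : \sum_(j < N) pr (T (F j) t i 0) * pr (T (F j) t i 0) =
    \sum_(j < N) pr (T (F j) t i 0) ^+ 2 by apply: eq_bigr => j _; rewrite expr2.
rewrite !sum_sq; have [k1|k2] : real_dim k = 1%N \/ real_dim k = 2%N by case: k; auto.
  rewrite k1 mul1r [X in _ + X]big1 ?addr0// => j _.
  by rewrite sIm_eq0// expr0n.
rewrite k2 mulr_natl mulr2n lerD//.
apply: (coord (@sIm R k)) => [|a z|v]; first exact: sImD.
  by rewrite sImM sRe_real sIm_real mul0r addr0.
by apply: le_trans (sq v i); rewrite lerDr sqr_ge0.
Qed.

End smoothing.

Section smoothing_multiplication.
Context (R : realType) (k : field_kind) (d : measure_display)
  (X : measurableType d) (m : {measure set X -> \bar R}) (n : nat).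
Local Notation K := (sfield R k).
Local Notation vfun := (X -> 'cV[K]_n).
Local Notation L2 := (@Lp R k d X m n 2%:E).
Local Notation l2 := (l2 k m n).
Local Notation b := (l2_inner k m n).
Local Notation lift := (@lift R k d X m n).
Context (V : X -> 'M[K]_n).
Hypotheses (V_measurable : mat_measurable V)
  (V_L2 : (mnorm m 2%:E V < +oo)%E) (V_Loo : (mnorm m +oo V < +oo)%E).
Local Notation W := (lift (mul_op V)).

Lemma measurable_sqr_frobenius :
  measurable_fun setT (fun x => frobenius (V x) ^+ 2).
Proof.
under eq_fun do rewrite sqr_frobenius.
apply: measurable_sum => i; apply: measurable_sum => j.
have [Vr Vi] := V_measurable i j.
by under eq_fun do rewrite sabsE; apply: measurable_funD; exact: measurable_funX.
Qed.

Lemma integral_sqr_frobenius :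
  (\int[m]_x (frobenius (V x) ^+ 2)%:E = (fine (mnorm m 2%:E V) ^+ 2)%:E)%E.
Proof.
have I0 : (0 <= \int[m]_x (frobenius (V x) ^+ 2)%:E)%E.
  by apply: integral_ge0 => x _; rewrite lee_fin sqr_ge0.
have -> : (mnorm m 2%:E V = (\int[m]_x (frobenius (V x) ^+ 2)%:E) `^ 2^-1)%E.
  rewrite /mnorm unlock /Lnorm; congr poweR; apply: eq_integral => x _.
  by rewrite /= ger0_norm ?frobenius_ge0// powR_mulrn ?frobenius_ge0.
have : (mnorm m 2%:E V = (\int[m]_x (frobenius (V x) ^+ 2)%:E) `^ 2^-1)%E.
  rewrite /mnorm unlock /Lnorm; congr poweR; apply: eq_integral => x _.
  by rewrite /= ger0_norm ?frobenius_ge0// powR_mulrn ?frobenius_ge0.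
move: I0 V_L2 => + + E1; rewrite E1; case: (\int[m]_x _)%E => [r r0 _|_|//].
  by rewrite poweR_EFin powR12_sqrt//= sqr_sqrtr.
by rewrite poweRyr.
Qed.

Context (T : vfun -> vfun).
Hypotheses (T_linear : linear_op m (total_op m T))
  (T_bounded : (opnorm m 2%:E +oo T < +oo)%E).

Lemma lift_totalE (x : l2) : l2fun (lift T x) = T x.
Proof. by apply: liftE; have [_ _ h _ _] := T_linear; apply: h; exact: l2P. Qed.

(** The pointwise bound of [smoothing_sum] is integrated against [frobenius (V x) ^+ 2], whose
    integral is the squared norm of [V]. *)
Lemma smoothing_multiplication_hs r N (F : nat -> l2) : 0 < r -> bessel b r N F ->
  \sum_(j < N) b (W (lift T (F j))) (W (lift T (F j))) <=
  (Num.sqrt (real_dim k)%:R * (Num.sqrt n%:R * fine (mnorm m 2%:E V) *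
     fine (opnorm m 2%:E +oo T)) * r) ^+ 2.
Proof.
move=> r0 bF; set v := fine _; set C := fine _.
pose f j x := rdot (mul_op V (T (F j)) x) (mul_op V (T (F j)) x).
have TL2 j : L2 (T (F j)) by rewrite -lift_totalE; exact: l2P.
have fE j : b (W (lift T (F j))) (W (lift T (F j))) = \int[m]_x f j x.
  by rewrite /l2_inner/= lift_mul_opE// lift_totalE.
have if_ j : m.-integrable setT (EFin \o f j).
  have [h _] := mul_op_bound V_measurable V_Loo (TL2 j).
  exact: (integrable_rdot h h).
rewrite -lee_fin -sumEFin (eq_bigr (fun j : 'I_N => (\int[m]_x (f j x)%:E)%E)); last first.
  by move=> j _; rewrite fE /Rintegral fineK//; exact: integrable_fin_num (if_ j).
rewrite -ge0_integral_sum//; last 2 first.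
- by move=> j; exact: measurable_int (if_ j).
- by move=> j x _; rewrite lee_fin rdot_ge0.
pose B := (n * real_dim k)%:R * (C * r) ^+ 2.
have B0 : 0 <= B by rewrite mulr_ge0 ?sqr_ge0.
have -> : (Num.sqrt (real_dim k)%:R * (Num.sqrt n%:R * v * C) * r) ^+ 2 = B * v ^+ 2.
  by rewrite /B natrM !exprMn !sqr_sqrtr//; ring.
rewrite EFinM -integral_sqr_frobenius -ge0_integralZl//; first last.
- by move=> x _; rewrite lee_fin sqr_ge0.
- by apply/measurable_EFinP; exact: measurable_sqr_frobenius.
apply: ae_ge0_le_integral => //.
- by move=> x _; apply: sume_ge0 => j _; rewrite lee_fin rdot_ge0.
- by apply: emeasurable_sum => j; exact: measurable_int (if_ j).
- by move=> x _; rewrite -EFinM lee_fin mulr_ge0 ?sqr_ge0.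
- by apply: measurable_funeM; apply/measurable_EFinP; exact: measurable_sqr_frobenius.
apply: filterS (smoothing_sum T_linear T_bounded r0 bF) => x hx _.
rewrite sumEFin -EFinM lee_fin mulrC.
apply: (@le_trans _ _ (\sum_(j < N) frobenius (V x) ^+ 2 * rdot (T (F j) x) (T (F j) x))).
  by apply: ler_sum => j _; exact: rdot_mulmx_le.
by rewrite -mulr_sumr ler_wpM2l ?sqr_ge0.
Qed.

End smoothing_multiplication.

(** * Operator norms on L^2 and real orthonormal families *)

Section operator_norm.
Context (R : realType) (k : field_kind) (d : measure_display)
  (X : measurableType d) (m : {measure set X -> \bar R}) (n : nat).
Local Notation l2 := (l2 k m n).
Local Notation b := (l2_inner k m n).
Context (S : (X -> 'cV[sfield R k]_n) -> X -> 'cV[sfield R k]_n) (L : l2 -> l2) (M : R).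
Hypotheses (LE : forall x, l2fun (L x) = S x)
  (L_sym : forall x y, b (L x) y = b x (L y))
  (M0 : 0 <= M) (L_le : forall x, nm b (L x) <= M * nm b x).

Lemma opnorm_le : (opnorm m 2%:E 2%:E S <= M%:E)%E.
Proof.
apply: ge_ereal_sup => _ [f [L2f f1] <-]; pose x : l2 := MkL2 L2f.
have x1 : nm b x <= 1 by rewrite -lee_fin -vnorm_l2.
rewrite -[f]/(l2fun x) -LE vnorm_l2 lee_fin; apply: (le_trans (L_le x)).
by rewrite -[leRHS]mulr1 ler_wpM2l.
Qed.

(** The a priori bound [M] makes the norm finite, so that [fine] loses nothing, and it settles
    vectors of length zero, which cannot be normalised. *)
Lemma le_opnorm x : nm b (L x) <= fine (opnorm m 2%:E 2%:E S) * nm b x.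
Proof.
have [x0|xn0] := eqVneq (nm b x) 0.
  by rewrite x0 mulr0; have := L_le x; rewrite x0 mulr0.
have x_gt0 : 0 < nm b x by rewrite lt_neqAle eq_sym xn0 nm_ge0.
(* Homogeneity of lengths is drawn from the symmetry of [L]. *)
have LZ (a : R) : nm b (L (a *: x)) = `|a| * nm b (L x).
  rewrite /nm L_sym ipZl -L_sym ipC L_sym ipZl -L_sym mulrA -expr2.
  by rewrite sqrtrM ?sqr_ge0// sqrtr_sqr.
have := opnorm_ge 2%:E S (x := (nm b x)^-1 *: x).
rewrite nmZ ger0_norm ?invr_ge0 ?nm_ge0// mulVf// => /(_ (lexx _)).
rewrite -LE vnorm_l2 LZ ger0_norm ?invr_ge0 ?nm_ge0//.
have fin : opnorm m 2%:E 2%:E S \is a fin_num.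
  rewrite ge0_fin_numE; first exact: le_lt_trans opnorm_le (ltry _).
  exact: opnorm_ge0.
by rewrite -{1}(fineK fin) lee_fin ler_pdivrMl// mulrC.
Qed.

End operator_norm.

Section doubling.
Context (R : realType) (k : field_kind) (d : measure_display)
  (X : measurableType d) (m : {measure set X -> \bar R}) (n : nat).
Local Notation l2 := (l2 k m n).
Local Notation b := (l2_inner k m n).

Definition imul (x : l2) : l2 := l2_lin (smk k 0 1) x 0.

Lemma imulE (x : l2) t : imul x t = smk k 0 1 *: x t.
Proof. by rewrite /imul/= addr0. Qed.

Lemma smk_complex (a c : R) : real_dim k = 2%N ->
  sRe (smk k a c) = a /\ sIm (smk k a c) = c.
Proof. by case: k. Qed.

Lemma ip_imul (x y : l2) : real_dim k = 2%N -> b (imul x) (imul y) = b x y.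
Proof.
move=> k2; have [r0 i1] := smk_complex 0 1 k2.
apply: eq_Rintegral => t _; rewrite !imulE; apply: eq_bigr => i _.
by rewrite !mxE !sReM !sImM r0 i1; ring.
Qed.

Lemma ip_imull (x y : l2) : real_dim k = 2%N ->
  b (imul x) y = - sIm (inner m x y).
Proof.
move=> k2; have [r0 i1] := smk_complex 0 1 k2.
rewrite /inner; have [_ ->] := smk_complex
  (Rintegral m setT (fun t => sRe (\sum_(i < n) x t i 0 * sconj (y t i 0))))
  (Rintegral m setT (fun t => sIm (\sum_(i < n) x t i 0 * sconj (y t i 0)))) k2.
set f := fun t => sIm _.
have -> : f = (fun t => -1 * rdot (imul x t) (y t)).
  apply/funext => t; rewrite /f imulE sIm_sum mulr_sumr; apply: eq_bigr => i _.
  by rewrite !mxE !sReM !sImM r0 i1 sRe_conj sIm_conj; ring.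
rewrite RintegralZl//; last exact: integrable_rdot (l2P _) (l2P _).
by rewrite mulN1r opprK.
Qed.

(* e' is e itself, followed by ie in the complex case. *)
Lemma real_orthonormal J (e : nat -> l2) :
  (forall i j, (i < J)%N -> (j < J)%N -> inner m (e i) (e j) = (i == j)%:R) ->
  exists e' : nat -> l2, orthonormal_family b (real_dim k * J) e' /\
    forall g : l2 -> R, (real_dim k = 2%N -> forall x, g (imul x) = g x) ->
      \sum_(j < real_dim k * J) g (e' j) =
      (real_dim k)%:R * \sum_(j < J) g (e j).
Proof.
move=> e_on.
have e_on' : orthonormal_family b J e.
  by move=> i j iJ jJ; rewrite l2_innerE e_on//; case: (i == j); case: k.
have [k1|k2] : real_dim k = 1%N \/ real_dim k = 2%N by case: k; auto.
  by rewrite k1 mul1n; exists e; split => // g _; rewrite mul1r.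
exists (fun q => if (q < J)%N then e q else imul (e (q - J)%N)); split.
  (* This holds for [i = j] too: the complex products are 0 or 1, hence real, and the product in
     question is minus their imaginary part. *)
  have cross i j : (i < J)%N -> (j < J)%N -> b (imul (e i)) (e j) = 0.
    move=> iJ jJ; rewrite ip_imull// e_on//.
    by case: (i == j); case: k; rewrite /= ?oppr0.
  have sub i : (i < real_dim k * J)%N -> ~~ (i < J)%N -> (i - J < J)%N.
    by rewrite k2 mul2n -addnn -leqNgt => iJ Ji; rewrite ltn_subLR.
  move=> i j iJ jJ; case: ifPn => hi; case: ifPn => hj.
  - exact: e_on'.
  - rewrite ipC cross ?sub// (_ : (i == j) = false)//.
    by apply/negbTE; apply: contraNneq hj => <-.
  - rewrite cross ?sub// (_ : (i == j) = false)//.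
    by apply/negbTE; apply: contraNneq hi => ->.
  - rewrite ip_imul// e_on' ?sub//; congr (_%:R); congr nat_of_bool.
    by rewrite -(eqn_add2r J) !subnK// leqNgt.
move=> g gi; rewrite k2 mul2n -addnn big_split_ord/= mulr_natl mulr2n.
congr (_ + _); apply: eq_bigr => j _; first by rewrite ltn_ord.
by rewrite ltnNge leq_addr/= addKn gi.
Qed.

Lemma total_op_imul (T : (X -> 'cV[sfield R k]_n) -> X -> 'cV[sfield R k]_n) x y :
  linear_op m (total_op m T) ->
  b (lift T (imul x)) y = b (imul (lift T x)) y.
Proof.
move=> linT; apply: l2_weak_eq; rewrite (lift_totalE linT).
have [_ _ _ _ lin] := linT; set a := smk k 0 1 : sfield R k.
(* With [a] the imaginary unit, [a x] is read as [(a - 1) x + x] to fit the form of linearity. *)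
have [_] := lin (a - 1) _ _ (l2P x) (l2P x).
have <- : l2fun (imul x) = (fun t => (a - 1) *: x t + x t).
  by apply/funext => t; rewrite imulE scalerBl scale1r subrK.
apply: filterS => t hT; rewrite imulE (lift_totalE linT).
by apply: etrans hT _; rewrite /= scalerBl scale1r subrK.
Qed.

Lemma imulB (x y : l2) : imul (x - y) = imul x - imul y.
Proof.
apply: l2_eq => t; rewrite imulE !l2_addE !l2_oppE !imulE.
by rewrite scalerDr scalerN.
Qed.

End doubling.

(** * From finite families to the Hilbert-Schmidt norm *)

(** [esum] is the supremum over finite subsets of [B], which may be uncountable, so duplicate-free
    lists suffice. *)
Lemma sqrte_esum_le (R : realType) (T : choiceType) (B : set T) (f : T -> \bar R)
    (Y : \bar R) : (forall x, 0 <= f x)%E -> (0 <= Y)%E ->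
  (forall s : seq T, uniq s -> (forall x, x \in s -> B x) ->
    sqrte (\sum_(x <- s) f x) <= Y)%E ->
  (sqrte (\esum_(x in B) f x) <= Y)%E.
Proof.
move=> f0 Y0 hY; apply: lee_sqrE => //; rewrite sqr_sqrte ?esum_ge0//.
apply: ge_ereal_sup => _ [A [Afin AB] <-].
have /finite_seqP[r AE] := Afin.
have {}AE : A = [set` undup r] by rewrite AE; apply/seteqP; split => x /=; rewrite mem_undup.
rewrite AE -fsbig_seq ?undup_uniq//.
have rB x : x \in undup r -> B x by move=> xr; apply: AB; rewrite AE.
have := hY (undup r) (undup_uniq r) rB.
by rewrite -(@lee_sqr _ _ Y) ?sqrte_ge0// sqr_sqrte// sume_ge0.
Qed.

Unset Implicit Arguments.
Set Strict Implicit.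

Theorem theorem2p9 (R : realType) (k : field_kind) (d : measure_display)
    (X : measurableType d) (m : {sigma_finite_measure set X -> \bar R})
    (n : nat) (n_gt0 : (0 < n)%N)
    (H : partial_op R k X n)
    (H_selfadjoint : selfadjoint m H) (H_ge0 : nonneg_op m H)
    (V : X -> 'M[sfield R k]_n)
    (V_measurable : mat_measurable V)
    (V_hermitian : forall x, is_hermitian (V x))
    (V_L2 : (mnorm m 2%:E V < +oo)%E) (V_Loo : (mnorm m +oo V < +oo)%E)
    (expH expHV : R -> (X -> 'cV[sfield R k]_n) -> (X -> 'cV[sfield R k]_n))
    (expH_def : is_semigroup m H expH)
    (expHV_def : is_semigroup m (perturbed H V) expHV)
    (t0 : R) (t0_gt0 : 0 < t0)
    (expH_bounded : (opnorm m 2%:E +oo (expH t0) < +oo)%E)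
    (expHV_bounded : (opnorm m 2%:E +oo (expHV t0) < +oo)%E) :
  (hsnorm m (fun f x => expH (2 * t0) f x - expHV (2 * t0) f x)%R
   <= (Num.sqrt n%:R)%:E * mnorm m 2%:E V *
      (opnorm m 2%:E +oo (expH t0) + opnorm m 2%:E +oo (expHV t0)) *
      \int[@lebesgue_measure R]_(s in `[0%R, t0]%classic)
        opnorm m 2%:E 2%:E (expHV s))%E.
Proof.
have [E [EH ET]] := expH_def; have [F [FA FS]] := expHV_def.
have domT (T : (X -> 'cV[sfield R k]_n) -> X -> 'cV[sfield R k]_n) :
    lift_dom (total_op m T) = [set: l2 k m n].
  by apply/seteqP; split => // x _; exact: l2P.
have linT s : 0 <= s -> linear_op m (total_op m (expH s)).
  by move=> /ET[].
have linS s : 0 <= s -> linear_op m (total_op m (expHV s)).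
  by move=> /FS[].
(* [perturbed H V] has the domain of [H] by definition, so both integrals share one [D], as
   [semigroup_difference_hs] requires. *)
have OH := lift_integral EH; have OA := lift_integral FA.
have OT s : 0 <= s -> op_integral (lift_spectral E) (fun t => expR (- (s * t)))
    setT (lift (expH s)).
  by move=> s0; rewrite -(domT (expH s)); exact: (lift_integral (ET s s0)).
have OS s : 0 <= s -> op_integral (lift_spectral F) (fun t => expR (- (s * t)))
    setT (lift (expHV s)).
  by move=> s0; rewrite -(domT (expHV s)); exact: (lift_integral (FS s s0)).
have [[_ _ HL2 _ _] _ _ _] := EH; have [[_ _ AL2 _ _] _ _ _] := FA.
pose b := l2_inner k m n; pose W := @lift R k d X m n (mul_op V).
have H_ge0' x : lift_dom H x -> 0 <= b (lift (act H) x) x.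
  by move=> Dx; rewrite l2_innerE liftE; [exact: H_ge0|exact: HL2].
have AE x y : lift_dom H x ->
    b (lift (act (perturbed H V)) x) y = b (lift (act H) x) y + b (W x) y.
  move=> Dx; rewrite -ipDl; congr (b _ y); apply: l2_eq => t.
  rewrite l2_addE liftE; last exact: AL2.
  by rewrite (liftE (HL2 _ Dx)) /W lift_mul_opE.
have W_sym x y : b (W x) y = b x (W y) by exact: lift_mul_op_sym.
pose c := fine (mnorm m +oo V).
have c0 : 0 <= c by exact: mnorm_infty_ge0.
have W_le x : nm b (W x) <= c * nm b x by exact: lift_mul_op_le.
pose v := fine (mnorm m 2%:E V).
pose C1 := fine (opnorm m 2%:E +oo (expH t0)).
pose C2 := fine (opnorm m 2%:E +oo (expHV t0)).
pose rk : R := Num.sqrt (real_dim k)%:R; pose rn : R := Num.sqrt n%:R.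
have v0 : 0 <= v by rewrite fine_ge0// Lnorm_ge0.
have C10 : 0 <= C1 by rewrite fine_ge0// opnorm_ge0.
have C20 : 0 <= C2 by rewrite fine_ge0// opnorm_ge0.
have rk0 : 0 < rk by rewrite sqrtr_gt0 ltr0n; case: (k).
have rn0 : 0 <= rn by exact: sqrtr_ge0.
have k10 : 0 <= rk * (rn * v * C1) by rewrite !mulr_ge0// ltW.
have k20 : 0 <= rk * (rn * v * C2) by rewrite !mulr_ge0// ltW.
have T_hs r K f : 0 < r -> bessel b r K f ->
    \sum_(j < K) b (W (lift (expH t0) (f j))) (W (lift (expH t0) (f j))) <=
    (rk * (rn * v * C1) * r) ^+ 2.
  by apply: smoothing_multiplication_hs => //; exact: linT (ltW t0_gt0).
have S_hs r K f : 0 < r -> bessel b r K f ->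
    \sum_(j < K) b (W (lift (expHV t0) (f j))) (W (lift (expHV t0) (f j))) <=
    (rk * (rn * v * C2) * r) ^+ 2.
  by apply: smoothing_multiplication_hs => //; exact: linS (ltW t0_gt0).
(* The norm is finite for [s >= 0] ([h_fin]), so [fine] does not change the integral. *)
pose h s := fine (opnorm m 2%:E 2%:E (expHV s)).
have h0 s : 0 <= s <= t0 -> 0 <= h s by rewrite fine_ge0// opnorm_ge0.
have S_le s x : 0 <= s -> nm b (lift (expHV s) x) <= expR (s * c) * nm b x.
  by move=> s0; apply: (semigroup_bound OA (A_ge H_ge0' AE W_le) x s0 (OS s s0)).
have SE s x : 0 <= s -> l2fun (@lift R k d X m n (expHV s) x) = expHV s x.
  by move=> s0; exact: lift_totalE (linS s s0) x.
have S_sym s x y : 0 <= s -> b (lift (expHV s) x) y = b x (lift (expHV s) y).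
  by move=> s0; exact: (op_sym (OS s s0)).
have S_h s x : 0 <= s <= t0 -> nm b (lift (expHV s) x) <= h s * nm b x.
  move=> /andP[s0 _]; apply: (@le_opnorm _ _ _ _ _ _ _ _ (expR (s * c))).
  - by move=> y; exact: SE.
  - by move=> y z; exact: S_sym.
  - exact: expR_ge0.
  - by move=> y; exact: S_le.
have h_fin s : 0 <= s -> opnorm m 2%:E 2%:E (expHV s) = (h s)%:E.
  move=> s0; rewrite fineK// ge0_fin_numE ?opnorm_ge0//.
  apply: le_lt_trans (ltry (expR (s * c))).
  apply: (@opnorm_le _ _ _ _ _ _ _ (lift (expHV s))).
  - by move=> y; exact: SE.
  - exact: expR_ge0.
  - by move=> y; exact: S_le.
have main := semigroup_difference_hs c0 OH OA H_ge0' AE W_sym W_le OT OS t0_gt0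
  k10 k20 T_hs S_hs h0 S_h.
set I := integral _ _ _.
have IE : I = (\int[@lebesgue_measure R]_(s in `[0%R, t0]) (h s)%:E)%E.
  apply: eq_integral => s; rewrite inE/= in_itv/= => /andP[s0 _].
  exact: h_fin.
rewrite -IE in main.
have I0 : (0 <= I)%E by apply: integral_ge0 => s _; exact: opnorm_ge0.
set Y := (_ * I)%E.
have YE : Y = ((rn * v * (C1 + C2))%:E * I)%E.
  have f1 : mnorm m 2%:E V = v%:E by rewrite fineK// ge0_fin_numE// Lnorm_ge0.
  have f2 : opnorm m 2%:E +oo (expH t0) = C1%:E.
    by rewrite fineK// ge0_fin_numE// opnorm_ge0.
  have f3 : opnorm m 2%:E +oo (expHV t0) = C2%:E.
    by rewrite fineK// ge0_fin_numE// opnorm_ge0.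
  by rewrite /Y f1 f2 f3.
have Y0 : (0 <= Y)%E.
  by rewrite YE mule_ge0// lee_fin !mulr_ge0// addr_ge0.
apply: ge_ereal_sup => _ [B [BL2 B1 B0 _] <-].
apply: sqrte_esum_le => // [f|s s_uniq sB].
  by rewrite expe_ge0// Lnorm_ge0.
(* Members of [s] belong to [B], hence to [Lp 2], so the default branch is not reached for
   [j < size s]. *)
pose e j : l2 k m n := if pselect (Lp m 2%:E (nth (fun=> 0) s j)) is left p
  then MkL2 p else 0.
have eE j : (j < size s)%N -> l2fun (e j) = nth (fun=> 0) s j.
  by move=> js; rewrite /e; case: pselect => // -[]; apply/BL2/sB; exact: mem_nth.
have e_on i j : (i < size s)%N -> (j < size s)%N ->
    inner m (e i) (e j) = (i == j)%:R.
  move=> is_ js; rewrite !eE//; have [<-|ij] := eqVneq i j.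
    by rewrite B1//; apply: sB; exact: mem_nth.
  rewrite B0//; [by apply: sB; exact: mem_nth..|].
  by apply/eqP; rewrite nth_uniq.
have [e' [e'_on e'_sum]] := real_orthonormal e_on.
have tt0 : 0 <= 2 * t0 by rewrite mulr_ge0// ltW.
pose Dif (x : l2 k m n) : l2 k m n :=
  lift (expH (2 * t0)) x - lift (expHV (2 * t0)) x.
have Dif_imul : real_dim k = 2%N -> forall x,
    b (Dif (imul x)) (Dif (imul x)) = b (Dif x) (Dif x).
  move=> k2 x.
  have Di z : b (Dif (imul x)) z = b (imul (Dif x)) z.
    rewrite ipBl (total_op_imul x z (linT _ tt0)) (total_op_imul x z (linS _ tt0)).
    by rewrite -ipBl imulB.
  by rewrite Di ipC Di ip_imul.
have := main _ _ e'_on; rewrite -/Dif.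
rewrite (e'_sum (fun x => b (Dif x) (Dif x)) Dif_imul).
set S := \sum_(j < size s) _ => main_s.
have -> : (\sum_(f <- s) vnorm m 2%:E
    (fun x => expH (2 * t0) f x - expHV (2 * t0) f x)%R ^+ 2)%E = S%:E.
  rewrite (big_nth (fun=> 0)) big_mkord -sumEFin; apply: eq_bigr => j _.
  rewrite (_ : (fun x => _) = l2fun (Dif (e j))).
    by rewrite vnorm_l2 -EFin_expe sqr_nm.
  apply/funext => x; rewrite l2_addE l2_oppE (lift_totalE (linT _ tt0)).
  by rewrite (lift_totalE (linS _ tt0)) eE.
(* The left side carries [rk] from the real family, and [rk] is a factor of both constants on the
   right. *)
rewrite YE; move: main_s; rewrite sqrtrM// -/rk -mulrDr -mulrDr !EFinM -!muleA.
by rewrite lee_pmul2l// muleA.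
Qed.
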